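(* There exists a universal constant $c>0$ such that for all integers $m\ge 1$ and $d\ge 2$ the following holds. Let $G$ be the $d$-dimensional grid graph $P_m\square\cdots\square P_m$ ($d$ factors) and let $N=m^d$ be its number of vertices. Then any embedding of the earth mover distance space $\mathrm{EMD}(G)$ into $L_1$ has bi-Lipschitz distortion at least $c\log N = c\,d\log m$; that is, if $C\ge 1$ and $F:\mathrm{EMD}(G)\to L_1(0,1)$ is a map with $\mathrm{EMD}(\mu,\nu)\le \|F(\mu)-F(\nu)\|_1\le C\,\mathrm{EMD}(\mu,\nu)$ for all $\mu,\nu\in \mathrm{EMD}(G)$, then $C\ge c\log N$.
   Context: $P_m$ is the path graph on $m$ nodes and $\square$ denotes the graph Cartesian product. Thus $G=(V,E)$ has vertex set $V=\{1,\dots,m\}^d$, with two vertices adjacent iff they differ by $\pm$ a standard basis vector; $d_G$ denotes the (unweighted) shortest path metric on $V$. For a real signed measure $\mu$ on $V$ with $\mu(V)=0$, the transportation cost norm $\|\mu\|_{\mathrm{TC}}$ is the infimum of $\sum_{i} a_i d_G(x_i,y_i)$ over all finite representations $\mu=\sum_i a_i(\delta_{x_i}-\delta_{y_i})$ with $a_i\ge 0$, $x_i,y_i\in V$. $\mathrm{EMD}(G)$ is the metric space of all probability measures on $V$ with the distance $\mathrm{EMD}(\mu,\nu)=\|\mu-\nu\|_{\mathrm{TC}}$. *)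

(* Defs.v *)
From mathcomp Require Import all_boot all_order all_algebra.
From mathcomp Require Import all_classical all_reals all_analysis.

Set Implicit Arguments.
Unset Strict Implicit.
Unset Printing Implicit Defensive.

Import Order.TTheory GRing.Theory Num.Theory.

Local Open Scope classical_set_scope.
Local Open Scope ring_scope.

(* The nodes of P_m are 0, ..., m - 1 instead of 1, ..., m. *)
Definition path_graph (m : nat) : rel 'I_m :=
  fun x y => (x.+1 == y :> nat) || (y.+1 == x :> nat).

(* Vertices of the d-fold Cartesian product are adjacent when they are adjacent
   in one coordinate and equal in all the others. *)
Definition cartesian_power (T : finType) (e : rel T) (d : nat) :
    rel {ffun 'I_d -> T} :=
  fun x y =>
    [exists i, e (x i) (y i) && [forall j, (j != i) ==> (x j == y j)]].

Definition grid_vertex (d m : nat) : finType := {ffun 'I_d -> 'I_m}.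

Definition grid_graph (d m : nat) : rel (grid_vertex d m) :=
  cartesian_power (@path_graph m) (d := d).

(* Infimum of the lengths (numbers of edges) of the walks from x to y; it is a
   minimum when y is reachable from x, and [inf set0 = 0] otherwise. *)
Definition graph_dist (R : realType) (T : finType) (e : rel T) (x y : T) : R :=
  inf [set (size p)%:R | p in [set p : seq T | path e x p /\ last x p = y]].

(* Since T is finite, a signed measure on T is identified with its mass
   function.  An entry ((a, x), y) of the list s stands for the term
   a (delta_x - delta_y). *)
Definition transport_repr (R : realType) (T : finType) (mu : {ffun T -> R})
    (s : seq (R * T * T)) : Prop :=
  (forall t, t \in s -> 0 <= t.1.1) /\
  (forall v, mu v = \sum_(t <- s) t.1.1 * ((t.1.2 == v)%:R - (t.2 == v)%:R)).

(* Only meaningful for mu of total mass 0, as for other mu there is no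
   representation and the value is the junk [inf set0 = 0]. *)
Definition tc_norm (R : realType) (T : finType) (dist : T -> T -> R)
    (mu : {ffun T -> R}) : R :=
  inf [set \sum_(t <- s) t.1.1 * dist t.1.2 t.2 | s in transport_repr mu].

Record prob_measure (R : realType) (T : finType) := ProbMeasure {
  mass :> {ffun T -> R};
  mass_ge0 : forall v, 0 <= mass v;
  mass_sum1 : \sum_v mass v = 1
}.

Definition EMD (R : realType) (T : finType) (e : rel T)
    (mu nu : prob_measure R T) : R :=
  tc_norm (graph_dist R e) (mass mu - mass nu).

Definition lebesgue01 (R : realType) :
    {measure set (measurableTypeR R) -> \bar R} :=
  mrestr (@lebesgue_measure R) (measurable_itv `]0%R, 1%R[).

Definition L1_01 (R : realType) := LspaceType1 (lebesgue01 R).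

(* The L_1 norm does not depend on the representatives of f and g. *)
Definition L1_dist (R : realType) (f g : L1_01 R) : \bar R :=
  ('N[lebesgue01 R]_1[(fun x => (f x - g x)%:E)])%E.

(* Main.v *)
From HB Require Import structures.
Require Import Defs.
From mathcomp Require Import all_boot all_order all_algebra.
From mathcomp Require Import all_classical all_reals all_analysis.
From mathcomp Require Import zify ring lra.

Set Implicit Arguments.
Unset Strict Implicit.
Unset Printing Implicit Defensive.

Import Order.TTheory GRing.Theory Num.Theory.

Local Open Scope ring_scope.

(** An L1 distance is an average of absolute values, so an embedding into L1 can
    be tested against any inequality between sums of terms [`|f mu - f nu|] that
    holds for all real functions [f] of a probability measure. The proof finds
    such an inequality for linear [f] and reduces general [f] to linear ones.

    For a linear functional, i.e. a function [phi] on the grid of side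
    [2 ^ k], the inequality is a Sobolev inequality, [dipole_sobolev]. At scale
    [r = 2 ^ j] put, on average, [d ^ 2] random dipoles in each block of side [r]: a
    source uniform in the grid and a sink uniform in the block of the source.
    Weighted by [r ^ (d - 1)], the expected absolute values of [phi] on these
    random measures, summed over all the scales, are at most [16 d] times the total
    variation of [phi]. By the co-area principle it suffices to take for [phi]
    the indicator of a set of size [s ^ d]. At scales [r >= s] the first moment
    is small because few dipoles meet the set; at scales [r < s] the second
    moment is small because the dipoles are independent and centred and only
    those near the boundary count. Both bounds decay geometrically away from [r = s],
    so the sum over the scales costs a constant only. The comparison uses the
    isoperimetric inequality [tvar_ind_ge], proved by entropy, and for sets that
    fill a definite part of the grid the Poincare inequality
    [tvar_ind_ge_poincare].

    On the other side no scale above a constant is cheap to transport: sources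
    and sinks are typically at distance about [d r] from each other
    ([avg_sink_dist_ge], a count of lattice points in l1 balls), so every such
    scale contributes [d] times the number of edges, up to a constant. Since an embedding of distortion [C] gives the edges
    total length at most [C] times their number, summing over about [k] scales
    yields [C >= c d k] ([linear_distortion_ge]).

    For the passage from a nonlinear embedding to linear ones ([linearization]),
    a lattice of measures [1 / N + eps * (h - |h| / N)] is drawn in the simplex
    and the embedding is averaged over boxes. Shifting a box only changes its
    boundary, so one step of the averaged map is nearly linear, whereas over
    displacements much longer than the box the averaging is invisible and the
    lower bound of the embedding survives; averaging over the base point then
    compares long displacements with single steps. Linear functionals with
    values in L1 satisfy the Sobolev inequality by integration.

    Finally a grid of arbitrary side contains isometric dyadic grids
    ([encode_isometric]): of comparable side when the side is large, and of side
    64 with the coordinates written in unary when the side is small and the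
    dimension is large. *)

(** * Averages over finite probability spaces *)

Section Average.
Variable R : realType.

Definition avg (T : finType) (f : T -> R) : R := (\sum_t f t) / #|T|%:R.

Lemma eq_avg (T : finType) (f g : T -> R) : f =1 g -> avg f = avg g.
Proof. by move=> fg; rewrite /avg; congr (_ / _); apply: eq_bigr. Qed.

Lemma ler_avg (T : finType) (f g : T -> R) :
  (forall t, f t <= g t) -> avg f <= avg g.
Proof.
by move=> fg; rewrite /avg ler_wpM2r ?invr_ge0 ?ler0n// ler_sum.
Qed.

Lemma avg_ge0 (T : finType) (f : T -> R) : (forall t, 0 <= f t) -> 0 <= avg f.
Proof. by move=> f0; rewrite divr_ge0 ?ler0n// sumr_ge0. Qed.

Lemma avg_sum (T : finType) (I : Type) (r : seq I) (P : pred I)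
    (F : I -> T -> R) :
  avg (fun t => \sum_(i <- r | P i) F i t) = \sum_(i <- r | P i) avg (F i).
Proof. by rewrite /avg exchange_big mulr_suml. Qed.

Lemma avgD (T : finType) (f g : T -> R) :
  avg (fun t => f t + g t) = avg f + avg g.
Proof. by rewrite /avg big_split mulrDl. Qed.

Lemma avgZ (T : finType) (a : R) (f : T -> R) :
  avg (fun t => a * f t) = a * avg f.
Proof. by rewrite /avg -mulr_sumr mulrA. Qed.

Lemma avg_cst (T : finType) (a : R) : (0 < #|T|)%N -> avg (fun _ : T => a) = a.
Proof.
move=> T0; rewrite /avg sumr_const -[_ *+ _]mulr_natr mulfK//.
by rewrite pnatr_eq0 -lt0n.
Qed.

Lemma avg_pair (T U : finType) (f : T * U -> R) :
  avg f = avg (fun t => avg (fun u => f (t, u))).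
Proof.
rewrite /avg -mulr_suml pair_bigA/= card_prod natrM invfM mulrA.
by rewrite mulrAC; congr (_ / _ / _); apply: eq_bigr => -[].
Qed.

Lemma reindex_avg (T : finType) (s : T -> T) (f : T -> R) :
  bijective s -> avg (fun t => f (s t)) = avg f.
Proof.
by move=> bs; rewrite /avg [in RHS](reindex s)//; apply: onW_bij.
Qed.

(** Jensen's inequality, from the nonnegativity of the variance. *)
Lemma sqr_avg_le (T : finType) (f : T -> R) : (0 < #|T|)%N ->
  avg f ^+ 2 <= avg (fun t => f t ^+ 2).
Proof.
move=> T0; set c := avg f.
have : 0 <= avg (fun t => (f t - c) ^+ 2) by apply: avg_ge0 => t; exact: sqr_ge0.
rewrite (@eq_avg _ _ (fun t => f t ^+ 2 + ((- (2 * c)) * f t + c ^+ 2))); last first.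
  by move=> t; ring.
rewrite !avgD avgZ avg_cst// -/c.
have -> : - (2 * c) * c + c ^+ 2 = - c ^+ 2 by ring.
by rewrite subr_ge0.
Qed.

(** Coordinates of a uniformly random function are independent. *)
Lemma avg_ffun_prod (I T : finType) (F : I -> T -> R) :
  avg (fun w : {ffun I -> T} => \prod_i F i (w i)) = \prod_i avg (F i).
Proof.
rewrite /avg -bigA_distr_bigA prodf_div; congr (_ / _).
by rewrite prodr_const card_ffun natrX.
Qed.

Lemma avg_ffun1 (I T : finType) (i : I) (g : T -> R) : (0 < #|T|)%N ->
  avg (fun w : {ffun I -> T} => g (w i)) = avg g.
Proof.
move=> T0; pose F j t := if j == i then g t else 1.
rewrite (@eq_avg _ _ (fun w : {ffun I -> T} => \prod_j F j (w j))); last first.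
  move=> w; rewrite (bigD1 i)//= /F eqxx big1 ?mulr1// => j /negbTE ->//.
rewrite avg_ffun_prod (bigD1 i)//= big1 ?mulr1.
  by apply: eq_avg => t; rewrite /F eqxx.
move=> j /negbTE ji; rewrite (@eq_avg _ _ (fun=> 1)) ?avg_cst// => t.
by rewrite /F ji.
Qed.

Lemma avg_ffun2M (I T : finType) (i j : I) (g h : T -> R) : (0 < #|T|)%N ->
  i != j -> avg (fun w : {ffun I -> T} => g (w i) * h (w j)) = avg g * avg h.
Proof.
move=> T0 ij; have ji : j != i by rewrite eq_sym.
pose F k t := if k == i then g t else if k == j then h t else 1.
rewrite (@eq_avg _ _ (fun w : {ffun I -> T} => \prod_k F k (w k))); last first.
  move=> w; rewrite (bigD1 i)//= (bigD1 j)//= /F eqxx (negbTE ji) eqxx big1 ?mulr1//.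
  by move=> k /andP[/negbTE -> /negbTE ->].
rewrite avg_ffun_prod (bigD1 i)//= (bigD1 j)//= big1 ?mulr1.
  congr (_ * _); apply: eq_avg => t; rewrite /F ?eqxx//.
  by rewrite (negbTE ji).
move=> k /andP[/negbTE ki /negbTE kj]; rewrite (@eq_avg _ _ (fun=> 1)) ?avg_cst//.
by move=> t; rewrite /F ki kj.
Qed.

(** A function of two arguments is a sum of products, so the product case
    [avg_ffun2M] suffices. *)
Lemma avg_ffun2 (I T : finType) (i j : I) (G : T -> T -> R) : (0 < #|T|)%N ->
  i != j -> avg (fun w : {ffun I -> T} => G (w i) (w j)) =
  avg (fun t => avg (G t)).
Proof.
move=> T0 ij.
rewrite (@eq_avg _ _ (fun w : {ffun I -> T} =>
  \sum_a (w i == a)%:R * G a (w j))); last first.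
  move=> w; rewrite (bigD1 (w i))//= eqxx mul1r big1 ?addr0// => a.
  by rewrite eq_sym => /negbTE ->; rewrite mul0r.
rewrite avg_sum [RHS]/avg mulr_suml; apply: eq_bigr => a _.
rewrite (avg_ffun2M (fun t => (t == a)%:R))// mulrC; congr (_ * _).
rewrite /avg (bigD1 a)//= eqxx big1 ?addr0 ?mul1r// => t /negbTE ->//.
Qed.

(** Second moment of a sum of independent centred variables: the mixed terms
    vanish. *)
Lemma avg_abs_sum_sqr (M : nat) (T : finType) (xi : T -> R) : (0 < #|T|)%N ->
  avg xi = 0 ->
  avg (fun w : {ffun 'I_M -> T} => `|\sum_i xi (w i)|) ^+ 2 <=
  M%:R * avg (fun t => xi t ^+ 2).
Proof.
move=> T0 xi0; have W0 : (0 < #|{: {ffun 'I_M -> T}}|)%N.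
  by rewrite card_ffun expn_gt0 T0.
apply: le_trans (sqr_avg_le _ W0) _.
rewrite (@eq_avg _ _ (fun w : {ffun 'I_M -> T} =>
   \sum_i \sum_j xi (w i) * xi (w j))); last first.
  move=> w; rewrite real_normK ?num_real// expr2 mulr_suml; apply: eq_bigr => i _.
  by rewrite mulr_sumr.
rewrite avg_sum -[X in X%:R]card_ord mulr_natl -sumr_const; apply: ler_sum => i _.
rewrite avg_sum (bigD1 i)//= big1 ?addr0.
  rewrite (avg_ffun1 i (fun t => xi t * xi t))//.
by move=> j ji; rewrite avg_ffun2M 1?eq_sym// xi0 mulr0.
Qed.

Lemma avg_abs_sum (M : nat) (T : finType) (xi : T -> R) : (0 < #|T|)%N ->
  avg (fun w : {ffun 'I_M -> T} => `|\sum_i xi (w i)|) <=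
  M%:R * avg (fun t => `|xi t|).
Proof.
move=> T0; apply: (@le_trans _ _ (avg (fun w : {ffun 'I_M -> T} =>
   \sum_i `|xi (w i)|))).
  by apply: ler_avg => w; exact: ler_norm_sum.
rewrite avg_sum (eq_bigr (fun=> avg (fun t => `|xi t|))).
  by rewrite sumr_const card_ord mulr_natl.
by move=> i _; rewrite (avg_ffun1 i (fun t => `|xi t|)).
Qed.

End Average.
(** * Total variation on the grid and random pairs in dyadic blocks *)

Section Grid.
Variables (d m : nat).
Notation V := (grid_vertex d m).

Definition upd (x : V) (i : 'I_d) (a : 'I_m) : V :=
  [ffun j => if j == i then a else x j].

Lemma upd_id (x : V) i : upd x i (x i) = x.
Proof. by apply/ffunP => j; rewrite ffunE; case: eqP => // ->. Qed.

Lemma upd_eq (x : V) i a : upd x i a i = a.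
Proof. by rewrite ffunE eqxx. Qed.

Lemma upd_upd (x : V) i a b : upd (upd x i a) i b = upd x i b.
Proof. by apply/ffunP => j; rewrite !ffunE; case: eqP. Qed.

(** The last index is its own successor, so that the missing edge contributes
    nothing to the total variation. *)
Definition nxt (a : 'I_m) : 'I_m := insubd a a.+1.

Lemma val_nxt (a : 'I_m) : val (nxt a) = if (a.+1 < m)%N then a.+1 else val a.
Proof. by rewrite val_insubd. Qed.

(** Summing over base points and directions counts every edge once. *)
Definition tvar (R : realType) (phi : V -> R) : R :=
  \sum_i \sum_(x : V) `|phi (upd x i (nxt (x i))) - phi x|.

Lemma line_le_var (R : realType) (r : nat) (psi : 'I_m -> R) (a b : 'I_m) :
  (a %/ r = b %/ r)%N ->
  `|psi a - psi b| <= \sum_(c : 'I_m | (c %/ r == a %/ r)%N) `|psi (nxt c) - psi c|.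
Proof.
wlog ab : a b / (a <= b)%N.
  move=> H e; case: (leqP (val a) (val b)) => [ab|/ltnW ba]; first exact: H.
  by rewrite distrC e; apply: H.
move=> e; pose q := (a %/ r)%N.
have main n : (a + n <= b)%N -> forall b' : 'I_m, val b' = (a + n)%N ->
    `|psi a - psi b'| <= \sum_(c : 'I_m | (c %/ r == q)%N && (c < a + n)%N) `|psi (nxt c) - psi c|.
  elim: n => [|n IH] nb b' b'E.
    have -> : b' = a by apply/val_inj; rewrite b'E addn0.
    by rewrite subrr normr0 sumr_ge0.
  have cm : (a + n < m)%N by have := ltn_ord b; lia.
  pose c := Ordinal cm.
  have b'c : b' = nxt c.
    apply/val_inj; rewrite val_nxt/= ifT; first by rewrite b'E addnS.
    by move: (ltn_ord b') b'E => /=; lia.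
  rewrite (bigD1 c)/=; last first.
    rewrite addnS ltnSn andbT /q eqn_leq; apply/andP; split.
      by rewrite e leq_div2r//; lia.
    by rewrite leq_div2r// leq_addr.
  rewrite b'c [leRHS]addrC.
  have -> : psi a - psi (nxt c) = (psi a - psi c) + (psi c - psi (nxt c)) by ring.
  apply: (le_trans (ler_normD _ _)); apply: lerD; last by rewrite distrC.
  apply: (le_trans (IH _ c erefl)); first lia.
  rewrite le_eqVlt; apply/orP; left; apply/eqP; apply: eq_bigl => k.
  rewrite -andbA; congr andb; rewrite addnS ltnS.
  rewrite -(inj_eq val_inj)/= ltn_neqAle andbC//.
apply: (le_trans (main (b - a)%N _ b _)); rewrite ?subnKC//.
rewrite [leRHS](bigID (fun c : 'I_m => (c < b)%N))/= -/q lerDl sumr_ge0//.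
Qed.

Lemma card_block_le (r : nat) (q : nat) :
  (0 < r)%N -> (#|[pred a : 'I_m | a %/ r == q]| <= r)%N.
Proof.
move=> r0; pose f (a : 'I_m) : 'I_r := Ordinal (ltn_pmod a r0).
rewrite -[X in (_ <= X)%N]card_ord.
rewrite -(card_in_imset (f := f)) ?max_card// => a b; rewrite !inE => /eqP aq /eqP bq [ab].
by apply/val_inj; rewrite /= (divn_eq a r) (divn_eq b r) aq bq ab.
Qed.

(** Exchanging a coordinate with a free index of the same block is an
    involution; after it the inner sum no longer depends on the free index,
    which takes at most [r] values. *)
Lemma resample_coord_le (R : realType) (r : nat) (phi : V -> R) (i : 'I_d) :
  (0 < r)%N ->
  \sum_(x : V) \sum_(c : 'I_m | (c %/ r == x i %/ r)%N)
     `|phi (upd x i (nxt c)) - phi (upd x i c)| <=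
  r%:R * \sum_(x : V) `|phi (upd x i (nxt (x i))) - phi x|.
Proof.
move=> r0; rewrite pair_big_dep/=.
pose s (p : V * 'I_m) := (upd p.1 i p.2, p.1 i).
have sK : involutive s.
  by move=> [x a]; rewrite /s/= upd_upd upd_id upd_eq.
rewrite (reindex s)/=; last by exists s => p _; rewrite sK.
under eq_bigr do rewrite !upd_upd upd_id.
under eq_bigl do rewrite upd_eq eq_sym.
rewrite -(pair_big_dep xpredT (fun (x : V) (c : 'I_m) => c %/ r == x i %/ r)%N (fun x c =>
  `|phi (upd x i (nxt (x i))) - phi x|))/=.
rewrite mulr_sumr; apply: ler_sum => x _.
rewrite sumr_const -[leLHS]mulr_natl ler_wpM2r// ler_nat.
exact: card_block_le.
Qed.

Section Blocks.
Variable r : nat.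
Hypotheses (r0 : (0 < r)%N) (rm : (r %| m)%N).
Notation O := {ffun 'I_d -> 'I_r}.

(** An index is determined by its block of length [r] and its offset in it;
    [set_offset] moves an index inside its block. *)
Definition set_offset (a : 'I_m) (b : 'I_r) : 'I_m := insubd a (a %/ r * r + b)%N.
Definition offset (a : 'I_m) (b : 'I_r) : 'I_r := insubd b (a %% r)%N.

Lemma val_set_offset a b : val (set_offset a b) = (a %/ r * r + b)%N.
Proof.
rewrite val_insubd ifT//; case/dvdnP: rm => q mE.
have aq : (a %/ r < q)%N by rewrite ltn_divLR// -mE.
rewrite [X in (_ < X)%N]mE (leq_trans (n := (a %/ r).+1 * r)%N)//.
  by rewrite mulSn addnC ltn_add2r.
by rewrite leq_mul2r aq orbT.
Qed.

Lemma val_offset a b : val (offset a b) = (a %% r)%N.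
Proof. by rewrite val_insubd ltn_pmod. Qed.

Lemma set_offset_div a b : (set_offset a b %/ r = a %/ r)%N.
Proof. by rewrite [X in (X %/ _)%N]val_set_offset divnMDl// (divn_small (ltn_ord b)) addn0. Qed.

Lemma set_offsetK a b : set_offset (set_offset a b) (offset a b) = a.
Proof. by apply/val_inj; rewrite val_set_offset set_offset_div val_offset -divn_eq. Qed.

Lemma offsetK a b : offset (set_offset a b) (offset a b) = b.
Proof. by apply/val_inj; rewrite val_offset [X in (X %% _)%N]val_set_offset modnMDl modn_small. Qed.

(** The point [p.1] is uniform in the grid, and [other p] is uniform in the
    block of side [r] that contains it. *)
Definition other (p : V * O) : V := [ffun j => set_offset (p.1 j) (p.2 j)].

(** Exchanging the chosen coordinates of the two points of a pair preserves the
    distribution of the pair. *)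
Definition swap (S : pred 'I_d) (p : V * O) : V * O :=
  ([ffun j => if S j then set_offset (p.1 j) (p.2 j) else p.1 j],
   [ffun j => if S j then offset (p.1 j) (p.2 j) else p.2 j]).

Lemma swapK S : involutive (swap S).
Proof.
move=> [x b]; rewrite /swap/=; congr (_, _); apply/ffunP => j; rewrite !ffunE;
  case: (S j) => //.
  by rewrite set_offsetK.
by rewrite offsetK.
Qed.

Lemma swap_bij S : bijective (swap S).
Proof. by exists (swap S); exact: swapK. Qed.

Lemma other_swapT p : other (swap xpredT p) = p.1.
Proof. by apply/ffunP => j; rewrite !ffunE/= set_offsetK. Qed.

Lemma avg_other (R : realType) (f : V -> R) :
  avg (fun p => f (other p)) = avg (fun p : V * O => f p.1).
Proof.
rewrite -(reindex_avg _ (swap_bij xpredT)); apply: eq_avg => p.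
by rewrite other_swapT.
Qed.

(** Walk from [p.1] to [other p] by changing one coordinate at a time. By the
    symmetry of [swap] every intermediate point is uniform, so each step is
    the resampling of one coordinate inside its block. *)
Lemma avg_block_diff_le (R : realType) (phi : V -> R) :
  avg (fun p => `|phi p.1 - phi (other p)|) <= r%:R * tvar phi / #|V|%:R.
Proof.
pose z (p : V * O) (n : nat) : V := (swap (fun j : 'I_d => (j < n)%N) p).1.
have z0 p : z p 0%N = p.1 by apply/ffunP => j; rewrite !ffunE.
have zd p : z p d = other p by apply/ffunP => j; rewrite !ffunE ltn_ord.
apply: (@le_trans _ _ (avg (fun p => \sum_(i < d) `|phi (z p i) - phi (z p i.+1)|))).
  apply: ler_avg => p; rewrite -z0 -zd.
  have : forall n, `|phi (z p 0%N) - phi (z p n)| <= \sum_(i < n) `|phi (z p i) - phi (z p i.+1)|.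
    elim=> [|n IH]; first by rewrite subrr normr0 big_ord0.
    rewrite big_ord_recr/= -(subrK (phi (z p n)) (phi (z p 0%N))) -addrA.
    by rewrite (le_trans (ler_normD _ _))// lerD.
  exact.
rewrite avg_sum /tvar mulr_sumr mulr_suml; apply: ler_sum => i _.
pose g (q : V * O) := `|phi q.1 - phi (upd q.1 i (set_offset (q.1 i) (q.2 i)))|.
rewrite (@eq_avg _ _ _ (fun p => g (swap (fun j : 'I_d => (j < i)%N) p))); last first.
  move=> p; congr (`|_ - phi _|); apply/ffunP => j; rewrite !ffunE/= ltnn.
  rewrite ltnS; case: (eqVneq j i) => [->|ji]; first by rewrite leqnn.
  by rewrite (leq_eqVlt j) (inj_eq val_inj) (negbTE ji).
rewrite (reindex_avg g (swap_bij _)) avg_pair.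
rewrite {1}/avg ler_wpM2r ?invr_ge0//.
apply: le_trans (resample_coord_le _ _ r0); apply: ler_sum => x _.
set B := \sum_(c : 'I_m | _) _.
have O0 : (0 < #|{: O}|)%N by rewrite card_ffun !card_ord expn_gt0 r0.
rewrite -[leRHS](avg_cst _ O0); apply: ler_avg => b /=.
have := @line_le_var R r (fun c => phi (upd x i c)) (x i) (set_offset (x i) (b i)).
by rewrite upd_id set_offset_div; exact.
Qed.

End Blocks.
End Grid.
(** * Isoperimetry *)

Section Isoperimetry.
Variables (R : realType) (d m : nat).
Notation V := (grid_vertex d m).

Definition ind (A : {set V}) (x : V) : R := (x \in A)%:R.

Lemma ler_ln_sub1 (u : R) : 0 < u -> ln u <= u - 1.
Proof.
move=> u0; have := @le_ln1Dx R (u - 1); rewrite (_ : 1 + (u - 1) = u); last by ring.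
by apply; rewrite ltrBDl addrN.
Qed.

Definition same_line (i : 'I_d) (x y : V) := [forall j, (j != i) ==> (x j == y j)].
Definition same_tail (n : nat) (x y : V) := [forall j : 'I_d, (n <= j)%N ==> (x j == y j)].

Lemma same_lineP i (x y : V) : reflect (forall j, j != i -> x j = y j) (same_line i x y).
Proof.
by apply: (iffP forallP) => H j; [move=> /(implyP (H j))/eqP|apply/implyP => /H ->].
Qed.

Lemma same_tailP n (x y : V) :
  reflect (forall j : 'I_d, (n <= j)%N -> x j = y j) (same_tail n x y).
Proof.
by apply: (iffP forallP) => H j; [move=> /(implyP (H j))/eqP|apply/implyP => /H ->].
Qed.

Lemma same_line_sym i x y : same_line i x y = same_line i y x.
Proof. by apply/same_lineP/same_lineP => H j /H. Qed.

Lemma same_line_trans i x y z : same_line i x y -> same_line i y z -> same_line i x z.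
Proof. by move=> /same_lineP H /same_lineP K; apply/same_lineP => j ji; rewrite H// K. Qed.

Lemma same_line_upd i x y : same_line i x y -> y = upd x i (y i).
Proof.
move/same_lineP => H; apply/ffunP => j; rewrite ffunE; case: (eqVneq j i) => [->//|ji].
by rewrite H.
Qed.

Lemma same_line_updr i x a : same_line i x (upd x i a).
Proof. by apply/same_lineP => j /negbTE ji; rewrite ffunE ji. Qed.

Variable A : {set V}.

Definition line_card i x : nat := #|[set y in A | same_line i x y]|.
Definition tail_card n x : nat := #|[set y in A | same_tail n x y]|.

Lemma line_card_gt0 i x : x \in A -> (0 < line_card i x)%N.
Proof.
move=> xA; rewrite card_gt0; apply/set0Pn; exists x; rewrite inE xA/=.
exact/same_lineP.
Qed.

Lemma tail_card_gt0 n x : x \in A -> (0 < tail_card n x)%N.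
Proof.
move=> xA; rewrite card_gt0; apply/set0Pn; exists x; rewrite inE xA/=.
exact/same_tailP.
Qed.

Lemma eq_line_card i x y : same_line i x y -> line_card i x = line_card i y.
Proof.
move=> xy; apply: eq_card => z; rewrite !inE; congr (_ && _).
apply/idP/idP => [|yz]; last exact: same_line_trans yz.
by apply: same_line_trans; rewrite same_line_sym.
Qed.

Lemma eq_tail_card (i : 'I_d) x y : same_line i x y -> tail_card i.+1 x = tail_card i.+1 y.
Proof.
move=> /same_lineP xy; apply: eq_card => z; rewrite !inE; congr (_ && _).
by apply/same_tailP/same_tailP => H j ij; rewrite -H// xy//;
  apply/negP => /eqP ji; rewrite ji ltnn in ij.
Qed.

(** A point on the line of [y] is determined by its coordinate [i], hence by any
    point with the same tail. *)
Lemma sum_tail_card_le (i : 'I_d) y :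
  (\sum_(x in A | same_line i x y) tail_card i x <= tail_card i.+1 y)%N.
Proof.
rewrite /tail_card.
under eq_bigr do rewrite -sum1_card.
rewrite (exchange_big_dep (mem A))/=; last by move=> x z _; rewrite inE => /andP[].
rewrite -sum1_card [leqRHS](eq_bigl (fun z => (z \in A) && same_tail i.+1 y z)); last first.
  by move=> z; rewrite inE.
rewrite [leqRHS]big_mkcondr; apply: leq_sum => z zA.
rewrite sum1_card; case: ifPn => [_|yz].
  rewrite (@leq_trans #|[set upd y i (z i)]|)//; last by rewrite cards1.
  apply/subset_leq_card/fintype.subsetP => x; rewrite unfold_in !inE => /andP[/andP[_ xy] /andP[_ /same_tailP xz]].
  by rewrite -xz// [X in X == _](@same_line_upd i y x)// same_line_sym.
rewrite leqn0; apply/eqP/eq_card0 => x; rewrite unfold_in !inE.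
apply/negP => /andP[/andP[_ /same_lineP xy] /andP[_ /same_tailP xz]].
move/negP: yz; apply; apply/same_tailP => j ij; rewrite -xz; last exact: ltnW.
by rewrite xy//; apply/negP => /eqP ji; rewrite ji ltnn in ij.
Qed.

(** Entropy inequality: revealing all the other coordinates rather than those
    after [i] can only decrease the conditional entropy of coordinate [i]. With
    [ln u <= u - 1] this becomes a double counting. *)
Lemma sum_ln_line_tail_le (i : 'I_d) :
  \sum_(x in A) ln ((line_card i x)%:R * (tail_card i x)%:R / (tail_card i.+1 x)%:R : R) <= 0.
Proof.
apply: (@le_trans _ _ (\sum_(x in A)
   ((line_card i x)%:R * (tail_card i x)%:R / (tail_card i.+1 x)%:R - 1))).
  apply: ler_sum => x xA; apply: ler_ln_sub1.
  by rewrite divr_gt0 ?mulr_gt0 ?ltr0n ?line_card_gt0 ?tail_card_gt0.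
rewrite sumrB subr_le0.
rewrite (eq_bigr (fun x => \sum_(y in A | same_line i x y)
   (tail_card i x)%:R / (tail_card i.+1 x)%:R)); last first.
  move=> x xA; rewrite -mulrA mulr_natl /line_card -sumr_const.
  by apply: eq_bigl => y; rewrite inE.
rewrite (exchange_big_dep (mem A))/=; last by move=> x y _ /andP[].
apply: ler_sum => y yA.
rewrite (eq_big (fun x => (x \in A) && same_line i x y)
  (fun x => (tail_card i x)%:R / (tail_card i.+1 y)%:R)); first last.
- by move=> x /andP[_ /andP[_ xy]]; rewrite (eq_tail_card xy).
- by move=> x; rewrite yA.
rewrite -mulr_suml -natr_sum ler_pdivrMr ?ltr0n ?tail_card_gt0// mul1r ler_nat.
exact: sum_tail_card_le.
Qed.

(** Chain rule: the entropy [ln #|A|] of a uniform point of [A] is the sum of the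
    conditional entropies of its coordinates given the later ones, which are
    compared with those given all the others by [sum_ln_line_tail_le]. *)
Lemma sum_ln_line_card_le :
  \sum_(x in A) \sum_i ln ((line_card i x)%:R : R) <= #|A|%:R * ln (#|A|%:R : R).
Proof.
have tail0 x : x \in A -> tail_card 0 x = 1%N.
  move=> xA; apply/eqP/cards1P; exists x; apply/setP => y; rewrite !inE.
  apply/andP/eqP => [[_ /same_tailP xy]|->]; last by split=> //; exact/same_tailP.
  by apply/ffunP => j; rewrite xy.
have taild x : tail_card d x = #|A|.
  apply: eq_card => y; rewrite !inE andb_idr// => _.
  by apply/same_tailP => j; rewrite leqNgt ltn_ord.
have S x : x \in A -> \sum_(i < d) ln ((line_card i x)%:R : R) = ln (#|A|%:R : R) +
    \sum_(i < d) ln ((line_card i x)%:R * (tail_card i x)%:R / (tail_card i.+1 x)%:R : R).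
  move=> xA; have pos n : (tail_card n x)%:R \is @Num.pos R.
    by rewrite posrE ltr0n tail_card_gt0.
  have posl i : (line_card i x)%:R \is @Num.pos R.
    by rewrite posrE ltr0n line_card_gt0.
  have tel : forall n, \sum_(i < n) (ln ((tail_card i x)%:R : R) - ln ((tail_card i.+1 x)%:R)) = - ln ((tail_card n x)%:R).
    elim=> [|n IH]; first by rewrite big_ord0 tail0// ln1 oppr0.
    by rewrite big_ord_recr/= IH; ring.
  rewrite -[in X in X + _](taild x) -[X in X + _]opprK -tel addrC -sumrB.
  apply: eq_bigr => i _; rewrite ln_div ?lnM//; first by ring.
  by rewrite posrE mulr_gt0 -?posrE.
rewrite (eq_bigr _ S) big_split/= sumr_const -[_ *+ _]mulr_natl gerDl.
by rewrite exchange_big; apply: sumr_le0 => i _; exact: sum_ln_line_tail_le.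
Qed.

Lemma card_same_line i (y : V) : #|[set z | same_line i y z]| = m.
Proof.
rewrite -[RHS]card_ord -(card_imset (f := upd y i)); last first.
  by move=> a b /(congr1 (fun x : V => x i)); rewrite !upd_eq.
apply: eq_card => z; rewrite inE; apply/idP/imsetP => [yz|[a _ ->]]; last first.
  exact: same_line_updr.
by exists (z i) => //; exact: same_line_upd.
Qed.

(** A line that meets [A] without being contained in it carries an edge of the
    boundary. *)
Lemma line_var_ge (i : 'I_d) : (0 < m)%N ->
  \sum_(x in A) ((line_card i x)%:R^-1 - m%:R^-1) <=
  \sum_(x : V) `|ind A (upd x i (nxt (x i))) - ind A x| :> R.
Proof.
move=> m0; have mp : (0 : R) < m%:R by rewrite ltr0n.
rewrite -(ler_pM2l mp); apply: le_trans (resample_coord_le (ind A) i m0).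
rewrite mulr_sumr.
rewrite (eq_bigr (fun x => \sum_(y in ~: A | same_line i x y) (line_card i x)%:R^-1)); last first.
  move=> x xA; rewrite sumr_const.
  have -> : #|[pred y in ~: A | same_line i x y]| = (m - line_card i x)%N.
    have mE := card_same_line i x.
    rewrite -(cardsID A) in mE; rewrite -[X in (X - _)%N]mE /line_card.
    rewrite [X in (_ - X)%N](_ : _ = #|[set z | same_line i x z] :&: A|).
      by rewrite addKn; apply: eq_card => y; rewrite !inE.
    by apply: eq_card => y; rewrite !inE andbC.
  have lm : (line_card i x <= m)%N.
    rewrite -[X in (_ <= X)%N](card_same_line i x); apply/subset_leq_card/fintype.subsetP => y.
    by rewrite !inE => /andP[].
  rewrite -[RHS]mulr_natl natrB// mulrBr mulrBl mulfV ?gt_eqF// mulfV//.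
  by rewrite gt_eqF// ltr0n line_card_gt0.
rewrite (exchange_big_dep (mem (~: A)))/=; last by move=> x y _ /andP[].
rewrite [leLHS]big_mkcond; apply: ler_sum => y _.
have S0 : 0 <= \sum_(c : 'I_m | (c %/ m == y i %/ m)%N) `|ind A (upd y i (nxt c)) - ind A (upd y i c)|.
  by apply: sumr_ge0.
rewrite inE; case: ifPn => // yA.
rewrite (eq_bigr (fun=> (line_card i y)%:R^-1)); last first.
  by move=> x /andP[_ /andP[_ xy]]; rewrite (eq_line_card xy).
rewrite sumr_const.
have -> : #|[pred x in A | (y \notin A) && same_line i x y]| = line_card i y.
  by apply: eq_card => x; rewrite !inE yA same_line_sym.
have [->//|] := posnP (line_card i y).
move=> lp; rewrite -[_ *+ _]mulr_natl mulfV; last by rewrite gt_eqF// ltr0n.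
move: lp; rewrite card_gt0 => /set0Pn[x]; rewrite inE => /andP[xA yx].
have := @line_le_var m R m (fun c => ind A (upd y i c)) (y i) (x i).
rewrite upd_id -same_line_upd// !divn_small// => /(_ erefl); apply: le_trans.
by rewrite /ind xA (negbTE yA) sub0r normrN normr1.
Qed.

(** If all the lines met the set in [s] points, as in a cube of side [s], there
    would be [d s ^ (d - 1)] of them, and those not contained in the set carry
    an edge of the boundary. In general [s] is the geometric mean of the sizes
    of the lines in an averaged sense, by [sum_ln_line_card_le], and convexity
    concludes. *)
Lemma tvar_ind_ge (s : R) : (0 < m)%N -> 0 < s -> s ^+ d = #|A|%:R ->
  d%:R * #|A|%:R * (s^-1 - m%:R^-1) <= tvar (ind A).
Proof.
move=> m0 s0 sd.
apply: (@le_trans _ _ (\sum_i \sum_(x in A) ((line_card i x)%:R^-1 - m%:R^-1))); last first.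
  by apply: ler_sum => i _; exact: line_var_ge.
rewrite exchange_big/=.
under eq_bigr do rewrite sumrB sumr_const card_ord.
rewrite sumrB sumr_const -[m%:R^-1 *+ d]mulr_natl -[_ / _ *+ _]mulr_natr.
rewrite mulrBr; apply: lerB; last by rewrite mulrAC.
apply: (@le_trans _ _ (\sum_(x in A) \sum_i s^-1 * (1 + ln s - ln ((line_card i x)%:R)))).
  under eq_bigr do rewrite -mulr_sumr sumrB sumr_const card_ord.
  rewrite -mulr_sumr sumrB sumr_const mulrC ler_wpM2l ?invr_ge0 ?(ltW s0)//.
  have := sum_ln_line_card_le; rewrite -sd lnXn//.
  rewrite -(mulr_natr _ #|A|) -(mulr_natl (1 + ln s)) -(mulr_natl (ln s)) -sd.
  set L := \sum_(x in A) _ => H; lra.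
apply: ler_sum => x xA; apply: ler_sum => i _.
have lp : (0 : R) < (line_card i x)%:R by rewrite ltr0n line_card_gt0.
have /ler_ln_sub1 : 0 < s / (line_card i x)%:R by rewrite divr_gt0.
rewrite ln_div ?posrE// => H.
rewrite -[leRHS](mulKf (lt0r_neq0 s0)) ler_wpM2l ?invr_ge0 ?(ltW s0)//; lra.
Qed.

(** Comparing with an independent pair gives the Poincare inequality of the
    whole grid. *)
Lemma tvar_ind_ge_poincare : (0 < m)%N -> (2 * #|A| <= #|V|)%N ->
  #|A|%:R <= m%:R * tvar (ind A).
Proof.
move=> m0 A2; have V0 : (0 < #|V|)%N by rewrite card_ffun !card_ord expn_gt0 m0.
have VR : (0 : R) < #|V|%:R by rewrite ltr0n.
have := avg_block_diff_le m0 (dvdnn m) (ind A).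
rewrite ler_pdivlMr// => /(le_trans _); apply.
rewrite avg_pair.
have -> : avg (fun x : V => avg (fun b : {ffun 'I_d -> 'I_m} => `|ind A x - ind A (other (x, b))|)) =
   avg (fun x : V => avg (fun b : V => `|ind A x - ind A b|)).
  apply: eq_avg => x; apply: eq_avg => b; congr (`|_ - ind A _|).
  apply/ffunP => j; rewrite ffunE/=; apply/val_inj; rewrite val_set_offset//.
  by rewrite divn_small.
have in_sum (f : V -> R) : \sum_x ind A x * f x = \sum_(x in A) f x.
  rewrite [RHS]big_mkcond; apply: eq_bigr => x _; rewrite /ind.
  by case: (x \in A); rewrite ?mul1r ?mul0r.
have sA : \sum_x ind A x = #|A|%:R.
  by rewrite -sum1_card natr_sum [RHS]big_mkcond; apply: eq_bigr => x _; rewrite /ind; case: (x \in A).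
have inner x : avg (fun b : V => `|ind A x - ind A b|) =
    ind A x + (1 - 2 * ind A x) * (#|A|%:R / #|V|%:R).
  rewrite (@eq_avg _ _ _ (fun b => ind A x + (1 - 2 * ind A x) * ind A b)).
    by rewrite avgD avg_cst// avgZ /avg sA.
  move=> b; rewrite /ind; case: (x \in A); case: (b \in A) => /=;
  rewrite ?mulr1n ?mulr0n ?subrr ?subr0 ?sub0r ?normr0 ?normrN ?normr1; ring.
under eq_avg do rewrite inner.
rewrite avgD.
under [X in _ + X]eq_avg do rewrite mulrC.
rewrite avgZ (@eq_avg _ _ (fun x => 1 - 2 * ind A x) (fun x => 1 + (-2) * ind A x)); last by move=> x; ring.
rewrite avgD avg_cst// avgZ /avg sA.
set a := #|A|%:R in A2 *; set n := #|V|%:R in VR A2 *.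
have : 2 * a <= n by rewrite /a /n -natrM ler_nat.
have -> : (a / n + a / n * (1 + -2 * (a / n))) * n = 2 * a - 2 * a * (a / n).
  by field; rewrite gt_eqF.
have a0 : 0 <= a by rewrite ler0n.
move=> an; have : a / n <= 1/2 by rewrite ler_pdivrMr//; lra.
nra.
Qed.

End Isoperimetry.
(** * The Sobolev inequality for sets *)

Section Scales.
Variable R : realType.

Lemma ler_of_sqr (x y : R) : 0 <= y -> x ^+ 2 <= y ^+ 2 -> x <= y.
Proof.
move=> y0 xy; case: (leP 0 x) => [x0|/ltW x0]; last exact: le_trans y0.
by rewrite -(@ler_pXn2r _ 2).
Qed.

Lemma sum_sqrt_dyadic_le (s : R) (k : nat) : 0 < s ->
  \sum_(j < k | 2 ^+ j < s) Num.sqrt (2 ^+ j / s) <= 4.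
Proof.
move=> s0; pose u n : R := Num.sqrt (2 ^+ n / s).
have r0 n : 0 <= 2 ^+ n / s by rewrite divr_ge0 ?exprn_ge0 ?(ltW s0).
have u0 n : 0 <= u n by apply: sqrtr_ge0.
have u2 n : u n ^+ 2 = 2 ^+ n / s by rewrite sqr_sqrtr.
have q1 n : (7/5) * u n <= u n.+1.
  apply: ler_of_sqr => //; rewrite exprMn !u2 (exprS 2 n) -(mulrA 2).
  by have := r0 n; set X := 2 ^+ n / s; lra.
suff: \sum_(j < k | 2 ^+ j < s) u j <= (5/2) * u k /\
      \sum_(j < k | 2 ^+ j < s) u j <= 4 by case.
elim: k => [|k [IH1 IH2]].
  by rewrite big_ord0; split; [rewrite mulr_ge0|].
rewrite big_mkcond big_ord_recr/= -big_mkcond/=.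
have := q1 k; have := u0 k; case: ifPn => ks uk0 uk1; last by split; lra.
have uk : u k <= 1.
  by apply: ler_of_sqr => //; rewrite u2 expr1n ler_pdivrMr// mul1r ltW.
split; lra.
Qed.

Lemma sum_inv_dyadic_le (s : R) (k : nat) : 0 < s ->
  \sum_(j < k | s <= 2 ^+ j) s / 2 ^+ j <= 2.
Proof.
move=> s0.
have p0 n : (0 : R) < 2 ^+ n by rewrite exprn_gt0.
have half n : s / 2 ^+ n.+1 = (s / 2 ^+ n) / 2 :> R.
  by rewrite exprS; field; rewrite gt_eqF.
suff: \sum_(j < k | s <= 2 ^+ j) s / 2 ^+ j <=
    if s <= 2 ^+ k then 2 - 2 * (s / 2 ^+ k) else 0.
  have sk : 0 <= s / 2 ^+ k by rewrite divr_ge0// ltW.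
  by case: ifP => _; lra.
elim: k => [|k IH].
  by rewrite big_ord0; case: ifPn => // h; rewrite expr0 divr1 in h *; lra.
rewrite big_mkcond big_ord_recr/= -big_mkcond/= half; case: ifPn IH => h IH.
  by rewrite ifT; [lra|rewrite (le_trans h)// exprS ler_peMl ?ltW//; lra].
rewrite addr0; apply: (le_trans IH); case: ifPn => // h'.
have : s / 2 ^+ k.+1 <= 1 by rewrite ler_pdivrMr// mul1r.
by rewrite half; lra.
Qed.

(** Here [s] is the linear size of a set, [p] its boundary and [e j] the weighted
    dipole average at scale [2 ^ j]. At scales below [s] the second moment bound
    is at most [p ^ 2] times a multiple of [2 ^ j / s], at scales above it the
    first moment bound is at most [p] times a multiple of [s / 2 ^ j]. The
    isoperimetric inequality serves when [2 s <= 2 ^ k]; otherwise all the scales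
    lie below [s], and the Poincare inequality suffices. *)
Lemma sum_scales_le (d k : nat) (s p : R) (e : nat -> R) :
  (2 <= d)%N -> 0 < s -> 0 <= p ->
  (forall j, (j < k)%N -> e j <= 2 * d%:R * s ^+ d / 2 ^+ j) ->
  (forall j, (j < k)%N -> e j ^+ 2 <= (2 ^+ j) ^+ d.-1 * p) ->
  d%:R * s ^+ d * (s^-1 - (2 ^+ k)^-1) <= p ->
  s ^+ d <= 2 ^+ k * p ->
  \sum_(j < k) e j <= 16 * p.
Proof.
move=> d2 s0 p0 H1 H2 H3 H4.
have P0 n : (0 : R) < 2 ^+ n by rewrite exprn_gt0.
have dR : 2 <= d%:R :> R by rewrite ler_nat.
have sd : s ^+ d = s * s ^+ d.-1 by rewrite -exprS prednK// (leq_trans _ d2).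
pose a := s ^+ d.-1.
have a0 : 0 < a by rewrite exprn_gt0.
have k0 j : (j < k)%N -> 2 * 2 ^+ j <= 2 ^+ k :> R.
  by move=> jk; rewrite -exprS ler_eXn2l// ltr1n.
have small j : 2 ^+ j < s -> (2 ^+ j) ^+ d.-1 <= a * (2 ^+ j / s).
  move=> js; rewrite /a; have [n ->] : exists n, d.-1 = n.+1.
    by exists d.-2; rewrite prednK// -ltnS prednK// (leq_trans _ d2).
  rewrite -[leLHS](@divfK _ (s ^+ n.+1)) ?gt_eqF ?exprn_gt0// mulrC.
  rewrite ler_wpM2l ?exprn_ge0 ?(ltW s0)// -expr_div_n exprS.
  rewrite ler_piMr// ?divr_ge0 ?(ltW s0) ?(ltW (P0 _))//.
  by rewrite exprn_ile1 ?divr_ge0 ?(ltW s0) ?(ltW (P0 _))// ler_pdivrMr ?mul1r// ltW.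
have key j : (j < k)%N ->
  e j <= if s <= 2 ^+ j then 4 * p * (s / 2 ^+ j) else 2 * p * Num.sqrt (2 ^+ j / s).
  move=> jk; have rs0 : 0 <= 2 ^+ j / s by rewrite divr_ge0// ltW.
  have [sm|sm] := leP (2 * s) (2 ^+ k).
    have pa : d%:R * a <= 2 * p.
      have : (2 ^+ k)^-1 <= s^-1 / 2.
        by rewrite -invfM lef_pV2 ?posrE ?mulr_gt0// mulrC.
      move=> kk; have : d%:R * s ^+ d * (s^-1 / 2) <= p.
        apply: le_trans H3; rewrite ler_wpM2l ?mulr_ge0 ?ler0n ?exprn_ge0 ?(ltW s0)//.
        lra.
      have -> : d%:R * s ^+ d * (s^-1 / 2) = d%:R * a / 2.
        by rewrite sd -/a; field; rewrite gt_eqF.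
      lra.
    case: ifPn => [sj|]; last rewrite -ltNge => sj.
      apply: (le_trans (H1 j jk)); rewrite sd -/a.
      have -> : 2 * d%:R * (s * a) / 2 ^+ j = 2 * (d%:R * a) * (s / 2 ^+ j) by ring.
      by rewrite ler_wpM2r ?divr_ge0 ?(ltW s0) ?(ltW (P0 _))//; lra.
    apply: ler_of_sqr; first by rewrite !mulr_ge0 ?sqrtr_ge0.
    apply: (le_trans (H2 j jk)); rewrite exprMn sqr_sqrtr//.
    have pa' : a <= p by nra.
    apply: (@le_trans _ _ (p * (2 ^+ j / s) * p)).
      rewrite ler_wpM2r//; apply: (le_trans (small _ sj)); exact: ler_wpM2r.
    have : 0 <= p ^+ 2 * (2 ^+ j / s) by rewrite mulr_ge0// sqr_ge0.
    by rewrite exprMn !expr2; lra.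
  have jk2 := k0 _ jk; have js : 2 ^+ j < s by lra.
  rewrite ifF; last by apply/negbTE; rewrite -ltNge.
  have pa : a <= 2 * p.
    have : s * a <= 2 * s * p.
      by rewrite -sd (le_trans H4)// ler_wpM2r// ltW.
    by rewrite mulrAC [_ * s]mulrC ler_pM2l.
  apply: ler_of_sqr; first by rewrite !mulr_ge0 ?sqrtr_ge0.
  apply: (le_trans (H2 j jk)); rewrite exprMn sqr_sqrtr//.
  apply: (@le_trans _ _ (2 * p * (2 ^+ j / s) * p)).
    rewrite ler_wpM2r//; apply: (le_trans (small _ js)); exact: ler_wpM2r.
  have : 0 <= p ^+ 2 * (2 ^+ j / s) by rewrite mulr_ge0// sqr_ge0.
  by rewrite exprMn !expr2; lra.
apply: (@le_trans _ _ (\sum_(j < k) (if s <= 2 ^+ j then 4 * p * (s / 2 ^+ j) else 2 * p * Num.sqrt (2 ^+ j / s)))).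
  by apply: ler_sum => j _; exact: key.
rewrite (bigID (fun j : 'I_k => s <= 2 ^+ j))/=.
rewrite (eq_bigr (fun j : 'I_k => 4 * p * (s / 2 ^+ j))); last by move=> j ->.
rewrite [X in _ + X](eq_big (fun j : 'I_k => 2 ^+ j < s) (fun j : 'I_k => 2 * p * Num.sqrt (2 ^+ j / s))); first last.
- by move=> j /negbTE ->.
- by move=> j; rewrite ltNge.
rewrite -[X in X + _]mulr_sumr -[X in _ + X]mulr_sumr.
have := sum_inv_dyadic_le k s0; have := sum_sqrt_dyadic_le k s0.
set S1 := \sum_(j < k | _) _; set S2 := \sum_(j < k | _) _ => h1 h2.
by have := ler_wpM2l p0 h1; have := ler_wpM2l p0 h2; lra.
Qed.

End Scales.

Section CutSobolev.
Variables (R : realType) (d k : nat).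
Hypothesis d2 : (2 <= d)%N.
Notation m := (2 ^ k)%N.
Notation V := (grid_vertex d m).
Notation pairs j := (V * {ffun 'I_d -> 'I_(2 ^ j)})%type.

(** On average [d ^ 2] atoms of each sign per block of side [2 ^ j]. *)
Definition natoms (j : nat) : nat := (d ^ 2 * (2 ^ (k - j)) ^ d)%N.

Definition dipole_avg (j : nat) (phi : V -> R) : R :=
  avg (fun w : {ffun 'I_(natoms j) -> pairs j} =>
    `|\sum_i (phi (w i).1 - phi (other (w i)))|).

Lemma card_pairs_gt0 j : (0 < #|{: pairs j}|)%N.
Proof. by rewrite card_prod !card_ffun !card_ord muln_gt0 !expn_gt0. Qed.

Lemma natoms_div j : (j <= k)%N ->
  (natoms j)%:R / #|V|%:R = d%:R ^+ 2 / (2 ^+ j) ^+ d :> R.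
Proof.
move=> jk; rewrite /natoms card_ffun !card_ord natrM !natrX.
have P0 n : (2 : R) ^+ n != 0 by rewrite expf_neq0.
rewrite -{2}(subnK jk) exprD exprMn; field.
by rewrite !expf_neq0.
Qed.

Lemma cut_sobolev (A : {set V}) : (2 * #|A| <= #|V|)%N ->
  \sum_(j < k) (2 ^+ j) ^+ d.-1 * dipole_avg j (ind R A) <=
  16 * d%:R * tvar (ind R A).
Proof.
move=> A2; have m0 : (0 < m)%N by rewrite expn_gt0.
have V0 : (0 < #|V|)%N by rewrite card_ffun !card_ord expn_gt0 m0.
have VR : (0 : R) < #|V|%:R by rewrite ltr0n.
have P0 n : (0 : R) < 2 ^+ n by rewrite exprn_gt0.
have d0 : (0 : R) < d%:R by rewrite ltr0n (leq_trans _ d2).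
set p := tvar (ind R A).
have p0 : 0 <= p by apply: sumr_ge0 => i _; exact: sumr_ge0.
pose q j := avg (fun t : pairs j => `|ind R A t.1 - ind R A (other t)|).
have jdvd j : (j < k)%N -> (2 ^ j %| m)%N by move=> jk; rewrite dvdn_exp2l// ltnW.
have j0 j : (0 < 2 ^ j)%N by rewrite expn_gt0.
have indA : avg (fun x : V => ind R A x) = #|A|%:R / #|V|%:R.
  rewrite /avg -sum1_card natr_sum [in RHS]big_mkcond; congr (_ / _).
  by apply: eq_bigr => x _; rewrite /ind; case: (x \in A).
have q1 j : (j < k)%N -> q j <= 2 * (#|A|%:R / #|V|%:R).
  move=> jk; apply: (@le_trans _ _ (avg (fun t : pairs j => ind R A t.1 + ind R A (other t)))).
    apply: ler_avg => t; rewrite (le_trans (ler_normB _ _))// !ger0_norm//.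
  rewrite avgD (avg_other (j0 j) (jdvd _ jk)).
  rewrite avg_pair (@eq_avg _ _ _ (ind R A)); first by rewrite indA; lra.
  by move=> x /=; rewrite avg_cst// card_ffun card_ord expn_gt0 j0.
have q2 j : (j < k)%N -> q j <= 2 ^+ j * p / #|V|%:R.
  by move=> jk; rewrite -natrX; apply: avg_block_diff_le; [exact: j0|exact: jdvd].
have dd : d = d.-1.+1 by rewrite prednK// (leq_trans _ d2).
have xd j : (2 ^+ j) ^+ d = 2 ^+ j * (2 ^+ j) ^+ d.-1 :> R by rewrite -exprS -dd.
pose e j := (2 ^+ j) ^+ d.-1 * dipole_avg j (ind R A) / d%:R.
have e1 j : (j < k)%N -> e j <= 2 * d%:R * #|A|%:R / 2 ^+ j.
  move=> jk; rewrite /e ler_pdivrMr//.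
  have := @avg_abs_sum R (natoms j) _ (fun t : pairs j => ind R A t.1 - ind R A (other t)) (card_pairs_gt0 j).
  rewrite -/(q j) -/(dipole_avg _ _) => h.
  have h' : dipole_avg j (ind R A) <= 2 * #|A|%:R * (d%:R ^+ 2 / (2 ^+ j) ^+ d).
    rewrite -natoms_div 1?ltnW//; apply: (le_trans h).
    apply: le_trans (ler_wpM2l (ler0n _ _) (q1 j jk)) _.
    by rewrite le_eqVlt; apply/orP; left; apply/eqP; ring.
  apply: le_trans (ler_wpM2l _ h') _; first by rewrite exprn_ge0 ?ltW.
  rewrite xd le_eqVlt; apply/orP; left; apply/eqP.
  by field; rewrite ?gt_eqF// exprn_gt0.
have e2 j : (j < k)%N -> e j ^+ 2 <= (2 ^+ j) ^+ d.-1 * p.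
  move=> jk.
  have := @avg_abs_sum_sqr R (natoms j) _ (fun t : pairs j => ind R A t.1 - ind R A (other t)) (card_pairs_gt0 j).
  have -> : avg (fun t : pairs j => (ind R A t.1 - ind R A (other t)) ^+ 2) = q j.
    apply: eq_avg => t; rewrite /ind; case: (_ \in A); case: (_ \in A);
    by rewrite ?subrr ?subr0 ?sub0r ?normrN ?normr1 ?normr0 ?sqrrN ?expr1n ?expr0n.
  rewrite -/(dipole_avg _ _) => h.
  have {}h : dipole_avg j (ind R A) ^+ 2 <= 2 ^+ j * p * (d%:R ^+ 2 / (2 ^+ j) ^+ d).
    rewrite -natoms_div 1?ltnW//; apply: (le_trans (h _)).
      rewrite (@eq_avg _ _ _ (fun t => ind R A t.1 + (-1) * ind R A (other t))); last by move=> t; ring.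
      by rewrite avgD avgZ (avg_other (j0 j) (jdvd _ jk)); ring.
    apply: le_trans (ler_wpM2l (ler0n _ _) (q2 j jk)) _.
    by rewrite le_eqVlt; apply/orP; left; apply/eqP; ring.
  rewrite /e exprMn exprMn exprVn ler_pdivrMr ?exprn_gt0//.
  apply: le_trans (ler_wpM2l _ h) _; first by rewrite exprn_ge0// exprn_ge0 ?ltW.
  rewrite xd le_eqVlt; apply/orP; left; apply/eqP.
  by field; rewrite ?gt_eqF// exprn_gt0.
suff S : \sum_(j < k) e j <= 16 * p.
  rewrite mulrAC -ler_pdivrMr// mulr_suml; exact: S.
have [A0|A0] := posnP #|A|.
  apply: (@le_trans _ _ (\sum_(j < k) 0)); last by rewrite sumr_const mul0rn mulr_ge0.
  by apply: ler_sum => j _; rewrite (le_trans (e1 j _))// A0 mulr0 mul0r.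
have AR : (0 : R) < #|A|%:R by rewrite ltr0n.
pose s : R := #|A|%:R `^ d%:R^-1.
have s0 : 0 < s by rewrite powR_gt0.
have sd : s ^+ d = #|A|%:R.
  by rewrite -powR_mulrn ?powR_ge0// /s -powRrM mulVf ?gt_eqF// powRr1// ltW.
apply: (@sum_scales_le _ d k s p e) => //; rewrite ?sd//.
- by rewrite -natrX; exact: tvar_ind_ge.
- by rewrite -natrX; exact: tvar_ind_ge_poincare.
Qed.

End CutSobolev.
(** * The Sobolev inequality for functions *)

Section Coarea.
Variables (R : realType) (d m : nat).
Notation V := (grid_vertex d m).

Lemma tvar_ge0 (phi : V -> R) : 0 <= tvar phi.
Proof. by apply: sumr_ge0 => i _; exact: sumr_ge0. Qed.

Lemma tvar_addc (phi : V -> R) (c : R) : tvar (fun x => phi x + c) = tvar phi.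
Proof.
apply: eq_bigr => i _; apply: eq_bigr => x _; congr `|_|; ring.
Qed.

(** A nonnegative function and the indicator of its support vary
    monotonically with respect to each other, so no cancellation occurs. *)
Lemma tvar_peel (phi : V -> R) (A : {set V}) (c : R) : 0 <= c ->
  (forall x, x \in A -> c <= phi x) -> (forall x, x \notin A -> phi x = 0) ->
  tvar phi = tvar (fun x => phi x - c * ind R A x) + c * tvar (ind R A).
Proof.
move=> c0 phiA phiN; rewrite /tvar mulr_sumr -big_split; apply: eq_bigr => i _ /=.
rewrite mulr_sumr -big_split; apply: eq_bigr => x _ /=.
set y := upd _ _ _; rewrite /ind.
case: (boolP (x \in A)) => xA; case: (boolP (y \in A)) => yA.
- by rewrite subrr normr0 mulr0 addr0; congr `|_|; ring.
- have := phiA _ xA; rewrite (phiN _ yA) => cx.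
  rewrite !(sub0r, mulr0, oppr0) !normrN normr1 !mulr1 !ger0_norm; [ring|lra|lra].
- have := phiA _ yA; rewrite (phiN _ xA) => cy.
  rewrite !(subr0, mulr0) normr1 !mulr1 !ger0_norm; [ring|lra|lra].
- by rewrite !(phiN _ xA, phiN _ yA) !(mulr0, subrr, normr0, addr0).
Qed.

(** Co-area principle, by peeling: subtracting from a nonnegative function a
    multiple of the indicator of its support makes the support smaller, and the
    total variation is additive along the way. *)
Lemma le_tvar_of_cuts (K : R) (L : (V -> R) -> R) : 0 <= K ->
  L (fun=> 0) <= 0 ->
  (forall f c, L f <= L (fun x => f x + c)) ->
  (forall f g c, 0 <= c -> L (fun x => f x + c * g x) <= L f + c * L g) ->
  (forall A : {set V}, L (ind R A) <= K * tvar (ind R A)) ->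
  forall phi, L phi <= K * tvar phi.
Proof.
move=> K0 L0 Lc LD LA.
have main n : forall phi : V -> R, (forall x, 0 <= phi x) ->
    (#|[set x | phi x != 0%R]| <= n)%N -> L phi <= K * tvar phi.
  elim: n => [|n IH] phi phi0.
    rewrite leqn0 cards_eq0 => /eqP S0.
    have -> : phi = fun=> 0.
      apply/funext => x; have : x \notin [set x | phi x != 0%R] by rewrite S0 inE.
      by rewrite inE negbK => /eqP.
    by rewrite (le_trans L0)// mulr_ge0// tvar_ge0.
  set A := [set x | phi x != 0%R] => An.
  have [A0|/set0Pn[x1 x1A]] := eqVneq A (@finset.set0 V).
    by apply: IH => //; rewrite -/A A0 cards0.
  case: (@Order.TotalTheory.arg_minP _ R V x1 (fun x => x \in A) phi x1A) => x0 x0A x0min.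
  pose c := phi x0.
  have c0 : 0 < c by rewrite lt_neqAle eq_sym phi0 andbT; rewrite inE in x0A.
  have phiN x : x \notin A -> phi x = 0 by rewrite inE negbK => /eqP.
  rewrite (@tvar_peel phi A c (ltW c0) x0min phiN).
  pose phi' x := phi x - c * ind R A x.
  have phiE : phi = fun x => phi' x + c * ind R A x.
    by apply/funext => x; rewrite /phi' subrK.
  rewrite [in L phi]phiE (le_trans (LD _ _ _ (ltW c0)))// mulrDr lerD//.
    apply: IH => [x|].
      rewrite /phi' /ind; case: (boolP (x \in A)) => [/x0min|/phiN ->].
        by rewrite mulr1 subr_ge0.
      by rewrite mulr0 subrr.
    rewrite -ltnS (leq_trans _ An)// [in X in (_ <= X)%N](cardsD1 x0) x0A add1n ltnS.
    apply/subset_leq_card/fintype.subsetP => x; rewrite !inE /phi' /ind => h.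
    apply/andP; split.
      apply: contraNneq h => ->; by rewrite x0A mulr1 subrr.
    apply: contraNneq h => px; have /negbTE -> : x \notin A by rewrite inE px eqxx.
    by rewrite px mulr0 subrr.
  by rewrite mulrCA ler_wpM2l ?(ltW c0).
move=> phi; pose b := \sum_x `|phi x|.
apply: (le_trans (Lc phi b)); rewrite -(tvar_addc phi b).
apply: (main #|V|) => [x|]; last exact: max_card.
have : `|phi x| <= b by rewrite /b (bigD1 x)//= lerDl sumr_ge0.
have := ler_norm (- phi x); rewrite normrN; lra.
Qed.

End Coarea.

Section Sobolev.
Variables (R : realType) (d k : nat).
Hypothesis d2 : (2 <= d)%N.
Notation V := (grid_vertex d (2 ^ k)).

Theorem dipole_sobolev (phi : V -> R) :
  \sum_(j < k) (2 ^+ j) ^+ d.-1 * dipole_avg j phi <= 16 * d%:R * tvar phi.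
Proof.
pose L (f : V -> R) := \sum_(j < k) (2 ^+ j) ^+ d.-1 * dipole_avg j f.
have w0 j : 0 <= (2 ^+ j) ^+ d.-1 :> R by rewrite !exprn_ge0.
have LC (A : {set V}) : L (ind R (~: A)) = L (ind R A).
  apply: eq_bigr => j _; congr (_ * _); apply: eq_avg => w.
  rewrite -normrN -sumrN; congr `|_|; apply: eq_bigr => i _; rewrite /ind !inE.
  by case: (_ \in A); case: (_ \in A) => /=; ring.
have tC (A : {set V}) : tvar (ind R (~: A)) = tvar (ind R A).
  apply: eq_bigr => i _; apply: eq_bigr => x _; rewrite -normrN /ind !inE.
  by congr `|_|; case: (_ \in A); case: (_ \in A) => /=; ring.
apply: (@le_tvar_of_cuts R _ _ (16 * d%:R) L).
- by rewrite mulr_ge0.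
- apply: sumr_le0 => j _; rewrite mulr_ge0_le0//.
  rewrite /dipole_avg (@eq_avg _ _ _ (fun=> 0)) ?avg_cst//.
    by rewrite card_ffun expn_gt0 card_pairs_gt0.
  by move=> w; rewrite big1 ?normr0// => i _; rewrite subrr.
- move=> f c; rewrite le_eqVlt; apply/orP; left; apply/eqP; apply: eq_bigr => j _.
  congr (_ * _); apply: eq_avg => w; congr `|_|; apply: eq_bigr => i _; ring.
- move=> f g c c0; rewrite /L mulr_sumr -big_split/=; apply: ler_sum => j _.
  rewrite [c * (_ * _)]mulrCA -mulrDr ler_wpM2l//.
  rewrite /dipole_avg -avgZ -avgD; apply: ler_avg => w.
  rewrite -[in leRHS](ger0_norm c0) -normrM (le_trans _ (ler_normD _ _))//.
  rewrite mulr_sumr -big_split/= le_eqVlt; apply/orP; left; apply/eqP.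
  by congr `|_|; apply: eq_bigr => i _; ring.
move=> A; have [A2|A2] := leqP (2 * #|A|) #|V|; first exact: cut_sobolev.
rewrite -LC -tC; apply: cut_sobolev => //.
have := cardsC A; move: A2; lia.
Qed.

End Sobolev.
(** * Transportation cost of the random dipoles *)

Section Packing.
Variables (R : realType).

Definition l1 (d m : nat) (x y : grid_vertex d m) : nat :=
  (\sum_i ((x i - y i) + (y i - x i)))%N.

Lemma l1_triangle d m (x y z : grid_vertex d m) : (l1 x z <= l1 x y + l1 y z)%N.
Proof. by rewrite /l1 -big_split/=; apply: leq_sum => i _; lia. Qed.

Definition capped_dist d m (rho : nat) (I : finType) (y : I -> grid_vertex d m)
    (z : grid_vertex d m) : nat :=
  \big[minn/rho]_i l1 z (y i).

Lemma capped_dist_le_l1 d m rho (I : finType) (y : I -> grid_vertex d m) z i :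
  (capped_dist rho y z <= l1 z (y i))%N.
Proof.
have : i \in index_enum I by exact: mem_index_enum.
rewrite /capped_dist; elim: (index_enum I) => // a s IH.
rewrite inE big_cons geq_min => /orP[/eqP <-|/IH ->]; by rewrite ?leqnn ?orbT.
Qed.

Lemma capped_dist_at d m rho (I : finType) (y : I -> grid_vertex d m) i :
  capped_dist rho y (y i) = 0%N.
Proof.
apply/eqP; rewrite -leqn0 (leq_trans (capped_dist_le_l1 _ _ _ i))//.
by rewrite /l1 big1// => a _; rewrite subnn.
Qed.

Lemma capped_dist_lip d m rho (I : finType) (y : I -> grid_vertex d m) z z' :
  (capped_dist rho y z <= capped_dist rho y z' + l1 z z')%N.
Proof.
rewrite /capped_dist; elim: (index_enum I) => [|a s IH].
  by rewrite !big_nil leq_addr.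
rewrite !big_cons addn_minl leq_min; apply/andP; split.
  by rewrite (leq_trans (geq_minl _ _))// addnC l1_triangle.
by rewrite (leq_trans (geq_minr _ _)).
Qed.

Definition decay (L n : nat) : R := 2 ^- (n %/ L).

Lemma decay_ge0 L n : 0 <= decay L n. Proof. by rewrite invr_ge0 exprn_ge0. Qed.

Lemma sum_decay_le (L : nat) : (0 < L)%N -> forall N,
  \sum_(0 <= n < N) decay L n <= 2 * L%:R.
Proof.
move=> L0; elim/ltn_ind => N IH; have [NL|LN] := leqP N L.
  apply: (@le_trans _ _ (\sum_(0 <= n < N) 1)).
    by apply: ler_sum => n _; rewrite invf_le1 ?exprn_gt0// exprn_ege1// ler1n.
  rewrite sumr_const_nat subn0.
  have : N%:R <= L%:R :> R by rewrite ler_nat.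
  have : (0:R) <= L%:R by []. lra.
rewrite (@big_cat_nat _ _ _ L)//= 1?ltnW//.
have -> : \sum_(L <= n < N) decay L n = \sum_(0 <= n < N - L) decay L (n + L).
  exact: (big_addn 0 N L xpredT (decay L)).
rewrite [X in _ + X](eq_bigr (fun n => decay L n / 2)); last first.
  move=> n _; rewrite /decay -{1}[L]mul1n addnC divnMDl// add1n exprS invfM mulrC//.
rewrite -mulr_suml.
have h1 : \sum_(0 <= n < L) decay L n <= L%:R.
  apply: (@le_trans _ _ (\sum_(0 <= n < L) 1)).
    by apply: ler_sum => n _; rewrite invf_le1 ?exprn_gt0// exprn_ege1// ler1n.
  by rewrite sumr_const_nat subn0.
have h2 : \sum_(0 <= n < N - L) decay L n <= 2 * L%:R by apply: IH; lia.
lra.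
Qed.

Lemma sum_decay_dist_le (L m x : nat) : (0 < L)%N ->
  \sum_(a < m) decay L ((x - a) + (a - x)) <= 4 * L%:R.
Proof.
move=> L0; rewrite -(big_mkord xpredT (fun a => decay L ((x - a) + (a - x)))).
apply: (@le_trans _ _ (\sum_(0 <= a < x + m) decay L ((x - a) + (a - x)))).
  rewrite [leRHS](@big_cat_nat _ _ _ m)//= ?leq_addl// lerDl sumr_ge0// => *.
  exact: decay_ge0.
rewrite (@big_cat_nat _ _ _ x)//= ?leq_addr//.
have -> : 4 * L%:R = 2 * L%:R + 2 * L%:R :> R by ring.
apply: lerD.
  apply: le_trans (sum_decay_le L0 x); rewrite big_nat_rev/= !big_nat.
  apply: ler_sum => a ax; rewrite /decay lef_pV2 ?posrE ?exprn_gt0//.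
  rewrite ler_eXn2l ?ltr1n// leq_div2r//; lia.
apply: le_trans (sum_decay_le L0 m); rewrite [leLHS](big_addn 0 (x + m) x xpredT (fun a => decay L (x - a + (a - x)))) addKn.
rewrite le_eqVlt; apply/orP; left; apply/eqP; apply: eq_bigr => a _.
by congr decay; lia.
Qed.

(** Exponential weights factor over the coordinates: the total weight is at most
    [(4 L) ^ d], and a point of the ball has weight at least [2 ^- d]. *)
Lemma card_l1_ball_le (d m L : nat) (x : grid_vertex d m) : (0 < L)%N ->
  #|[set y | l1 x y <= d * L]%N|%:R <= (8 * L%:R) ^+ d :> R.
Proof.
move=> L0.
pose W (y : grid_vertex d m) : R := \prod_i decay L ((x i - y i) + (y i - x i)).
have W0 y : 0 <= W y by apply: prodr_ge0 => i _; exact: decay_ge0.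
have sW : \sum_y W y <= (4 * L%:R) ^+ d.
  rewrite -(bigA_distr_bigA (fun i (a : 'I_m) => decay L ((x i - a) + (a - x i)))).
  rewrite -[in leRHS](card_ord d) -prodr_const; apply: ler_prod => i _.
  by rewrite sumr_ge0 ?sum_decay_dist_le// => *; exact: decay_ge0.
have bW y : (l1 x y <= d * L)%N -> 2 ^- d <= W y.
  move=> xy; rewrite /W /decay prodfV prodrXr lef_pV2 ?posrE ?exprn_gt0//.
  rewrite ler_eXn2l ?ltr1n//.
  rewrite -(@leq_pmul2r L)//; apply: leq_trans xy.
  by rewrite big_distrl/=; apply: leq_sum => i _; exact: leq_trunc_div.
have : #|[set y | l1 x y <= d * L]%N|%:R * 2 ^- d <= (4 * L%:R) ^+ d :> R.
  apply: le_trans sW; rewrite mulr_natl -sumr_const big_mkcond; apply: ler_sum => y _.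
  by rewrite inE; case: ifP => // /bW.
rewrite ler_pdivrMr ?exprn_gt0// -exprMn; congr (_ <= _ ^+ _); ring.
Qed.

Section RandomDipoles.
Variables (d k j : nat).
Hypotheses (d2 : (2 <= d)%N) (j5 : (5 <= j)%N) (jk : (j < k)%N).
Notation m := (2 ^ k)%N.
Notation r := (2 ^ j)%N.
Notation V := (grid_vertex d m).
Notation T := (V * {ffun 'I_d -> 'I_r})%type.
Notation L := (2 ^ (j - 5))%N.

Lemma avg_indic_le (U : finType) (p : pred U) (c : nat) :
  (0 < #|U|)%N -> (#|[set u | p u]| <= c)%N ->
  avg (fun u => (p u)%:R : R) <= c%:R / #|U|%:R.
Proof.
move=> U0 pc; rewrite /avg ler_wpM2r ?invr_ge0//.
apply: le_trans (_ : #|[set u | p u]|%:R <= _); last by rewrite ler_nat.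
rewrite -sum1_card natr_sum [leRHS]big_mkcond/=; apply: ler_sum => u _.
by rewrite inE; case: (p u).
Qed.

(** A source and a sink are seldom closer than [d L], where [L = r / 32]: the ball
    count [(8 L) ^ d] is compared with the block of the source if they belong
    to the same dipole, and with the whole grid if they are independent. *)
Lemma close_pair_prob_le (i i' : 'I_(natoms d k j)) :
  avg (fun w : {ffun 'I_(natoms d k j) -> T} =>
    (l1 (w i).1 (other (w i')) <= d * L)%N%:R : R) <=
  if i == i' then 4 ^- d else (8 * L%:R) ^+ d / #|V|%:R.
Proof.
have m0 : (0 < m)%N by rewrite expn_gt0.
have r0 : (0 < r)%N by rewrite expn_gt0.
have rm : (r %| m)%N by rewrite dvdn_exp2l// ltnW.
have L0 : (0 < L)%N by rewrite expn_gt0.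
have V0 : (0 < #|V|)%N by rewrite card_ffun !card_ord expn_gt0 m0.
have T0 := card_pairs_gt0 d k j.
have ball (x : V) : avg (fun y : V => (l1 x y <= d * L)%N%:R : R) <= (8 * L%:R) ^+ d / #|V|%:R.
  apply: le_trans (avg_indic_le V0 (leqnn _)) _.
  by rewrite ler_wpM2r ?invr_ge0// card_l1_ball_le.
case: eqP => [<-|/eqP ii'].
  rewrite (avg_ffun1 i (fun t : T => (l1 t.1 (other t) <= d * L)%N%:R))//.
  rewrite avg_pair/= -[leRHS](avg_cst _ V0); apply: ler_avg => x.
  have O0 : (0 < #|{: {ffun 'I_d -> 'I_r}}|)%N by rewrite card_ffun !card_ord expn_gt0 r0.
  apply: le_trans (avg_indic_le O0 (_ : _ <= #|[set y : V | (l1 x y <= d * L)%N]|)%N) _.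
    rewrite -(card_in_imset (f := fun b => other (x, b))); last first.
      move=> b c _ _ /ffunP bc; apply/ffunP => a; apply/val_inj.
      have := congr1 val (bc a); rewrite !ffunE/= !val_set_offset//; exact: addnI.
    by apply/subset_leq_card/fintype.subsetP => y /imsetP[b]; rewrite !inE => h ->.
  rewrite card_ffun !card_ord ler_pdivrMr ?ltr0n ?expn_gt0 ?r0//.
  apply: (le_trans (card_l1_ball_le x L0)).
  have -> : r = (32 * L)%N by rewrite (_ : 32 = 2 ^ 5)%N// -expnD subnKC.
  move: L0; set l := L => l0; have lR : (0 : R) < l%:R by rewrite ltr0n.
  rewrite natrX natrM -exprVn -exprMn le_eqVlt; apply/orP; left; apply/eqP.
  by congr (_ ^+ _); field.
rewrite (avg_ffun2 (fun t u : T => (l1 t.1 (other u) <= d * L)%N%:R))//.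
have -> : avg (fun t : T => avg (fun u : T => (l1 t.1 (other u) <= d * L)%N%:R : R)) =
    avg (fun t : T => avg (fun y : V => (l1 t.1 y <= d * L)%N%:R : R)).
  apply: eq_avg => t; rewrite (avg_other r0 rm (fun y => (l1 t.1 y <= d * L)%N%:R)).
  rewrite avg_pair; apply: eq_avg => y /=; rewrite avg_cst// card_ffun !card_ord.
  by rewrite expn_gt0 r0.
rewrite -[leRHS](avg_cst _ T0); apply: ler_avg => t; exact: ball.
Qed.

Lemma pow4_ge (n : nat) : (2 <= n)%N -> (2 * (n ^ 2 + 1) <= 4 ^ n)%N.
Proof.
elim: n => // n IH; rewrite leq_eqVlt => /orP[/eqP <-//|n2].
have := IH n2; rewrite (expnS 4); nia.
Qed.

Definition sink_dist (w : {ffun 'I_(natoms d k j) -> T}) : V -> nat :=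
  capped_dist (d * L) (fun i => other (w i)).

(** The expected number of sinks close to a given source is at most
    [(d ^ 2 + 1) / 4 ^ d <= 1 / 2]. *)
Lemma avg_sink_dist_ge :
  (natoms d k j)%:R * ((d * L)%:R / 2) <=
  avg (fun w => \sum_i (sink_dist w (w i).1)%:R) :> R.
Proof.
set M := natoms d k j; set rho := (d * L)%N.
have T0 := card_pairs_gt0 d k j.
have W0 : (0 < #|{: {ffun 'I_M -> T}}|)%N by rewrite card_ffun expn_gt0 T0.
have low (w : {ffun 'I_M -> T}) z : rho%:R * (1 - \sum_i (l1 z (other (w i)) <= rho)%N%:R) <= (sink_dist w z)%:R :> R.
  rewrite /sink_dist /capped_dist; have [/existsP[i il]|] := boolP [exists i, l1 z (other (w i)) <= rho]%N.
    apply: (@le_trans _ _ 0); last by rewrite ler0n.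
    rewrite mulr_ge0_le0// subr_le0 (bigD1 i)//= il lerDl sumr_ge0//.
  rewrite negb_exists => /forallP far.
  rewrite big1 ?subr0 ?mulr1; last by move=> i _; rewrite (negbTE (far i)).
  rewrite ler_nat; elim/big_ind: _ => //; first by move=> a b; rewrite leq_min => -> ->.
  by move=> i _; apply: ltnW; rewrite ltnNge far.
apply: (@le_trans _ _ (avg (fun w : {ffun 'I_M -> T} => \sum_i rho%:R *
    (1 - \sum_i' (l1 (w i).1 (other (w i')) <= rho)%N%:R)))); last first.
  by apply: ler_avg => w; apply: ler_sum => i _; exact: low.
rewrite avg_sum -[in leLHS](card_ord M) mulr_natl -sumr_const; apply: ler_sum => i _.
rewrite avgZ ler_wpM2l//.
rewrite (@eq_avg _ _ _ (fun w : {ffun 'I_M -> T} => 1 + (-1) *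
   \sum_i' (l1 (w i).1 (other (w i')) <= rho)%N%:R)); last by move=> w; ring.
rewrite avgD avgZ avg_cst// avg_sum.
suff : \sum_i' avg (fun w : {ffun 'I_M -> T} => (l1 (w i).1 (other (w i')) <= rho)%N%:R : R) <= 2^-1.
  set S := \sum_i' _; lra.
have rL : r = (32 * L)%N by rewrite (_ : 32 = 2 ^ 5)%N// -expnD subnKC.
have LR : (0 : R) < L%:R by rewrite ltr0n expn_gt0.
have Mq : M%:R * ((8 * L%:R) ^+ d / #|V|%:R) = d%:R ^+ 2 * 4 ^- d :> R.
  rewrite mulrCA mulrC natoms_div 1?ltnW// (_ : 2 ^+ j = (32 * L)%:R); last by rewrite -rL natrX.
  rewrite -mulrA; congr (_ * _).
  move: LR; set l := L => LR; rewrite natrM.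
  by rewrite -exprVn -exprMn -exprVn; congr (_ ^+ _); field; rewrite gt_eqF.
have q0 : 0 <= (8 * L%:R) ^+ d / #|V|%:R :> R by rewrite divr_ge0// exprn_ge0.
apply: (@le_trans _ _ (4 ^- d + M%:R * ((8 * L%:R) ^+ d / #|V|%:R))).
  rewrite (bigD1 i)//= lerD//.
    by apply: le_trans (close_pair_prob_le i i) _; rewrite eqxx.
  rewrite -[in leRHS](card_ord M) mulr_natl -sumr_const big_mkcond; apply: ler_sum => i' _.
  case: ifPn => // ii'; apply: le_trans (close_pair_prob_le i i') _.
  by rewrite eq_sym (negbTE ii').
rewrite Mq -[X in X + _]mul1r -mulrDl ler_pdivrMr ?exprn_gt0//.
have := pow4_ge d2; rewrite -(ler_nat R) natrM natrD !natrX.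
set D := d%:R ^+ 2; set P := _ ^+ d; lra.
Qed.

End RandomDipoles.
End Packing.
(** * Averaging over boxes of multisets *)

Section Seminorm.
Variables (R : realType) (W : lmodType R) (nrm : W -> R).

Definition seminorm := (forall a b, nrm (a + b) <= nrm a + nrm b) /\
  (forall c a, nrm (c *: a) = `|c| * nrm a).

Hypothesis nP : seminorm.

Lemma seminormD a b : nrm (a + b) <= nrm a + nrm b. Proof. exact: nP.1. Qed.

Lemma seminormZ c a : nrm (c *: a) = `|c| * nrm a. Proof. exact: nP.2. Qed.

Lemma seminorm0 : nrm 0 = 0.
Proof. by rewrite -(scale0r 0) seminormZ normr0 mul0r. Qed.

Lemma seminormN a : nrm (- a) = nrm a.
Proof. by rewrite -scaleN1r seminormZ normrN normr1 mul1r. Qed.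

Lemma seminormB a b : nrm (a - b) <= nrm a + nrm b.
Proof. by rewrite -(seminormN b) seminormD. Qed.

Lemma seminormBC a b : nrm (a - b) = nrm (b - a).
Proof. by rewrite -seminormN opprB. Qed.

Lemma seminorm_ge0 a : 0 <= nrm a.
Proof. by have := seminormB a a; rewrite subrr seminorm0; lra. Qed.

Lemma seminorm_sum (I : Type) (r : seq I) (P : pred I) (F : I -> W) :
  nrm (\sum_(i <- r | P i) F i) <= \sum_(i <- r | P i) nrm (F i).
Proof.
elim/big_rec2 : _ => [|i x y _ h]; first by rewrite seminorm0.
by rewrite (le_trans (seminormD _ _))// lerD2l.
Qed.

Lemma seminorm_triangle a b c : nrm (a - c) <= nrm (a - b) + nrm (b - c).
Proof. by rewrite (le_trans _ (seminormD _ _))// addrA subrK. Qed.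

Definition vavg (U : finType) (f : U -> W) : W := #|U|%:R^-1 *: \sum_u f u.

Lemma seminorm_vavg (U : finType) (f : U -> W) : nrm (vavg f) <= avg (fun u => nrm (f u)).
Proof.
rewrite /vavg seminormZ ger0_norm ?invr_ge0// mulrC ler_wpM2r ?invr_ge0//.
exact: seminorm_sum.
Qed.

Lemma vavgB (U : finType) (f g : U -> W) :
  vavg f - vavg g = vavg (fun u => f u - g u).
Proof. by rewrite /vavg -scalerBr -sumrB. Qed.

Lemma vavg_cst (U : finType) (a : W) : (0 < #|U|)%N -> vavg (fun _ : U => a) = a.
Proof.
move=> U0; rewrite /vavg sumr_const -(scaler_nat _ a) scalerA mulVf ?scale1r//.
by rewrite pnatr_eq0 -lt0n.
Qed.

Lemma reindex_vavg (U : finType) (s : U -> U) (f : U -> W) :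
  bijective s -> vavg (fun t => f (s t)) = vavg f.
Proof.
by move=> bs; rewrite /vavg [in RHS](reindex s)//; apply: onW_bij.
Qed.

End Seminorm.

Section Multisets.
Variable V : finType.
Notation mset := {ffun V -> nat}.

Definition delta (x : V) : mset := [ffun v => (v == x : nat)].

Definition msize (h : mset) : nat := (\sum_v h v)%N.

Lemma msizeD (h k : mset) : msize (h + k) = (msize h + msize k)%N.
Proof. by rewrite /msize -big_split; apply: eq_bigr => v _; rewrite ffunE. Qed.

Lemma msize0 : msize 0 = 0%N.
Proof. by rewrite /msize big1// => v _; rewrite ffunE. Qed.

Lemma msize_delta x : msize (delta x) = 1%N.
Proof.
rewrite /msize (bigD1 x)//= ffunE eqxx big1// => v /negbTE vx.
by rewrite ffunE vx.
Qed.

Lemma msizeMn (h : mset) n : msize (h *+ n) = (msize h * n)%N.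
Proof.
elim: n => [|n IH]; first by rewrite mulr0n muln0 msize0.
by rewrite mulrS msizeD IH mulnS.
Qed.

Lemma mset_ind (P : mset -> Prop) :
  P 0 -> (forall z x, P z -> P (z + delta x)) -> forall z, P z.
Proof.
move=> P0 PS z; have [n] := ubnP (msize z); elim: n z => // n IH z zn.
have [z0|] := posnP (msize z).
  suff -> : z = 0 by [].
  apply/ffunP => v; rewrite ffunE; apply/eqP; rewrite -leqn0 -z0 /msize.
  by rewrite (bigD1 v)//= leq_addr.
rewrite lt0n /msize sum_nat_eq0 => /forallPn[x]; rewrite negb_imply /= => zx.
pose z' : mset := [ffun v => (z v - (v == x))%N].
have zE : z = z' + delta x.
  apply/ffunP => v; rewrite !ffunE; case: (eqVneq v x) => [->|_] /=.
    by rewrite -[RHS]/((z x - 1) + 1)%N subnK// lt0n.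
  by rewrite subn0 addr0.
rewrite zE; apply: PS; apply: IH; rewrite zE msizeD msize_delta in zn.
by rewrite addn1 ltnS in zn.
Qed.

Definition mset_of (s : seq V) : mset := \sum_(x <- s) delta x.

Lemma mset_of_nil : mset_of [::] = 0. Proof. by rewrite /mset_of big_nil. Qed.

Lemma mset_of_cons x s : mset_of (x :: s) = delta x + mset_of s.
Proof. by rewrite /mset_of big_cons. Qed.

Lemma msize_mset_of s : msize (mset_of s) = size s.
Proof.
elim: s => [|x s IH]; first by rewrite mset_of_nil msize0.
by rewrite mset_of_cons msizeD msize_delta IH.
Qed.

Section Box.
Variable M : nat.
Notation box := {ffun V -> 'I_M}.

Definition emb (u : box) : mset := [ffun v => nat_of_ord (u v)].

Lemma msize_emb u : (msize (emb u) <= M * #|V|)%N.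
Proof.
rewrite mulnC -sum_nat_const; apply: leq_sum => v _; rewrite ffunE.
exact/ltnW/ltn_ord.
Qed.

Definition shift_coord (x : V) (u : box) : box :=
  [ffun v => if v == x then ordS (u v) else u v].

Lemma shift_coord_bij x : bijective (shift_coord x).
Proof.
exists (fun u : box => [ffun v => if v == x then ord_pred (u v) else u v] : box).
  by move=> u; apply/ffunP => v; rewrite !ffunE; case: eqP => // _; rewrite ordSK.
by move=> u; apply/ffunP => v; rewrite !ffunE; case: eqP => // _; rewrite ord_predK.
Qed.

(** The cyclic shift of a coordinate is a translation except on one face. *)
Lemma emb_shift_coord x (u : box) : ((u x).+1 < M)%N -> emb (shift_coord x u) = emb u + delta x.
Proof.
move=> ux; apply/ffunP => v; rewrite !ffunE; case: eqP => [->|_] /=.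
  by rewrite modn_small// [RHS]addrC.
by rewrite addr0.
Qed.

Lemma card_box_gt0 : (0 < M)%N -> (0 < #|{: box}|)%N.
Proof. by move=> M0; rewrite card_ffun card_ord expn_gt0 M0. Qed.

End Box.
End Multisets.

Section BoxShift.
Variables (R : realType) (V : finType) (W : lmodType R) (nrm : W -> R).
Hypothesis nP : seminorm nrm.
Notation mset := {ffun V -> nat}.
Variables (M n : nat).
Hypothesis M0 : (0 < M)%N.

Definition bavg (g : mset -> W) : W := vavg (fun u : {ffun V -> 'I_M} => g (emb u)).

(** The translated and the cyclically shifted averages differ only on the face
    where the shift wraps around, a fraction [1 / M] of the box. *)
Lemma box_shift1 (g : mset -> W) (b : R) x :
  (forall h, (msize h <= n)%N -> nrm (g h) <= b) -> (M * #|V| < n)%N ->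
  nrm (bavg (fun h => g (h + delta x)) - bavg g) <= 2 * b / M%:R.
Proof.
move=> gb Mn.
rewrite /bavg -(reindex_vavg (fun u => g (emb u)) (shift_coord_bij M x)) vavgB.
apply: (le_trans (seminorm_vavg nP _)).
apply: (@le_trans _ _ (avg (fun u : {ffun V -> 'I_M} => (fun c : 'I_M => 2 * b * (c.+1 == M)%:R) (u x)))).
  apply: ler_avg => u /=; have [uM|uM] := eqVneq (u x).+1 M.
    rewrite mulr1 (le_trans (seminormB nP _ _))//.
    have h1 : nrm (g (emb u + delta x)) <= b.
      by apply: gb; rewrite msizeD msize_delta addn1 (leq_ltn_trans (msize_emb u)).
    have h2 : nrm (g (emb (shift_coord x u))) <= b.
      by apply: gb; rewrite (leq_trans (msize_emb _))// ltnW.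
    lra.
  rewrite emb_shift_coord ?subrr ?(seminorm0 nP) ?mulr0//.
  by rewrite ltn_neqAle uM ltn_ord.
rewrite (avg_ffun1 x (fun c : 'I_M => 2 * b * (c.+1 == M)%:R)) ?card_ord//.
rewrite avgZ le_eqVlt; apply/orP; left; apply/eqP; congr (_ * _).
have lM : (M.-1 < M)%N by rewrite prednK.
rewrite /avg card_ord (bigD1 (Ordinal lM))//= prednK// eqxx big1 ?addr0 ?div1r//.
move=> c; rewrite -(inj_eq val_inj)/= => cM.
case: (eqVneq c.+1 M) => // cM1; move: cM; rewrite -[X in X != _]/(c.+1.-1) cM1.
by rewrite eqxx.
Qed.

End BoxShift.

Lemma box_shift (R : realType) (V : finType) (W : lmodType R) (nrm : W -> R)
    (M n : nat) (g : {ffun V -> nat} -> W) (b : R) (z : {ffun V -> nat}) :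
  seminorm nrm -> (0 < M)%N ->
  (forall h, (msize h <= n)%N -> nrm (g h) <= b) -> (M * #|V| + msize z <= n)%N ->
  nrm (bavg M (fun h => g (h + z)) - bavg M g) <= 2 * b * (msize z)%:R / M%:R.
Proof.
move=> nP M0 gb; move: z; apply: mset_ind => [|z x IH] zn.
  rewrite msize0 mulr0 mul0r [X in nrm (X - _)](_ : _ = bavg M g).
    by rewrite subrr seminorm0.
  by congr vavg; apply/funext => u; rewrite addr0.
rewrite msizeD msize_delta addn1 addnS in zn.
rewrite msizeD msize_delta natrD mulrDr mulr1 mulrDl [leRHS]addrC.
apply: (le_trans (seminorm_triangle nP _ (bavg M (fun h => g (h + z))) _)); apply: lerD; last first.
  by apply: IH; rewrite ltnW.
rewrite [X in X - _](_ : _ = bavg M (fun h => (fun h' => g (h' + z)) (h + delta x))).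
  apply: (@box_shift1 _ _ _ _ nP M (n - msize z)) => //; last by lia.
  by move=> h hn; apply: gb; rewrite msizeD; lia.
by congr vavg; apply/funext => u; rewrite -addrA [z + _]addrC.
Qed.

Lemma normr_seminorm (R : realType) : seminorm (W := R^o) (fun a : R => `|a|).
Proof. by split=> [a b|c a]; [exact: ler_normD|exact: normrM]. Qed.

Definition bavgr (R : realType) (V : finType) (M : nat) (g : {ffun V -> nat} -> R) : R :=
  avg (fun u : {ffun V -> 'I_M} => g (emb u)).

Lemma box_shift_real (R : realType) (V : finType)
    (M n : nat) (g : {ffun V -> nat} -> R) (b : R) (z : {ffun V -> nat}) :
  (0 < M)%N -> (forall h, 0 <= g h) ->
  (forall h, (msize h <= n)%N -> g h <= b) -> (M * #|V| + msize z <= n)%N ->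
  bavgr M (fun h => g (h + z)) <= bavgr M g + 2 * b * (msize z)%:R / M%:R.
Proof.
move=> M0 g0 gb zn.
have := @box_shift R V R^o _ M n g b z (normr_seminorm R) M0 _ zn.
have E (f : {ffun V -> nat} -> R) : bavg (W := R^o) M f = bavgr M f.
  by rewrite /bavg /vavg /bavgr /avg mulrC.
rewrite !E => /(_ _)/(le_trans (ler_norm _)) h.
rewrite -lerBlDl; apply: h => h hn; rewrite ger0_norm//; exact: gb.
Qed.
(** * Linearization of Lipschitz maps *)

Section Smoothing.
Variables (R : realType) (V : finType) (W : lmodType R) (nrm : W -> R).
Hypothesis nP : seminorm nrm.
Notation mset := {ffun V -> nat}.
Variables (dist : V -> V -> R) (C B : R) (n : nat) (Phi : mset -> W).

(** A multiset [h] stands for a measure near the uniform one. Moving a point of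
    [h] costs at most [C] times its displacement, adding a point at most [B]. *)
Definition lip_upto := forall h, (msize h < n)%N ->
  (forall x y, nrm (Phi (h + delta x) - Phi (h + delta y)) <= C * dist x y) /\
  (forall x, nrm (Phi (h + delta x) - Phi h) <= B).

Hypothesis PhiL : lip_upto.
Variable M : nat.
Hypothesis M0 : (0 < M)%N.
Notation N := #|V|.

Definition smooth (h : mset) : W := bavg M (fun u => Phi (u + h)).

Lemma smoothB h k : smooth h - smooth k =
  vavg (fun u : {ffun V -> 'I_M} => Phi (emb u + h) - Phi (emb u + k)).
Proof. by rewrite /smooth /bavg vavgB. Qed.

Lemma Phi_edge_le h x y : (msize h < n)%N ->
  nrm (Phi (h + delta x) - Phi (h + delta y)) <= 2 * B.
Proof.
move=> hn; have [_ H] := PhiL hn.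
apply: (le_trans (seminorm_triangle nP _ (Phi h) _)); rewrite (seminormBC nP (Phi h)).
by have := H x; have := H y; lra.
Qed.

Lemma smooth_lip h x y : (M * N + msize h < n)%N ->
  nrm (smooth (h + delta x) - smooth (h + delta y)) <= C * dist x y.
Proof.
move=> hn; rewrite smoothB; apply: (le_trans (seminorm_vavg nP _)).
rewrite -[leRHS](avg_cst _ (card_box_gt0 V M0)); apply: ler_avg => u.
rewrite !addrA; apply: (PhiL _).1; rewrite msizeD.
by apply: leq_ltn_trans hn; rewrite leq_add2r msize_emb.
Qed.

Lemma smooth_edge_le h x y : (M * N + msize h < n)%N ->
  nrm (smooth (h + delta x) - smooth (h + delta y)) <= 2 * B.
Proof.
move=> hn; rewrite smoothB; apply: (le_trans (seminorm_vavg nP _)).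
rewrite -[leRHS](avg_cst _ (card_box_gt0 V M0)); apply: ler_avg => u.
rewrite !addrA; apply: Phi_edge_le; rewrite msizeD.
by apply: leq_ltn_trans hn; rewrite leq_add2r msize_emb.
Qed.

Lemma Phi_shift_le h z : (msize h + msize z <= n)%N ->
  nrm (Phi (h + z) - Phi h) <= B * (msize z)%:R.
Proof.
move: z; apply: mset_ind => [|z x IH] hn.
  by rewrite addr0 subrr (seminorm0 nP) msize0 mulr0.
rewrite msizeD msize_delta in hn *.
apply: (le_trans (seminorm_triangle nP _ (Phi (h + z)) _)).
rewrite natrD mulrDr mulr1 addrC; apply: lerD; first by apply: IH; lia.
by rewrite addrA; apply: (PhiL _).2; rewrite msizeD; lia.
Qed.

(** Averaging moves the values by at most the size of the box: negligible against
    much longer displacements. *)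
Lemma smooth_close h : 0 <= B -> (M * N + msize h <= n)%N ->
  nrm (smooth h - Phi h) <= B * (M * N)%:R.
Proof.
move=> B0 hn; have box0 := card_box_gt0 V M0.
rewrite -[X in _ - X](vavg_cst _ box0) /smooth /bavg vavgB.
apply: (le_trans (seminorm_vavg nP _)); rewrite -[leRHS](avg_cst _ box0).
apply: ler_avg => u; rewrite [emb u + h]addrC.
apply: (le_trans (Phi_shift_le _)).
  by rewrite addnC (leq_trans _ hn)// leq_add2r msize_emb.
by rewrite ler_wpM2l// ler_nat msize_emb.
Qed.

(** The increments of the smoothed map hardly depend on the base point: moving
    it by [z] only changes the contribution of the boundary of the box. *)
Lemma smooth_edge_shift h z x y : (M * N + msize h + msize z < n)%N ->
  nrm ((smooth (h + z + delta x) - smooth (h + z + delta y)) -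
       (smooth (h + delta x) - smooth (h + delta y))) <=
  4 * B * (msize z)%:R / M%:R.
Proof.
move=> hn; pose g (u : mset) := Phi (u + (h + delta x)) - Phi (u + (h + delta y)).
have -> : smooth (h + z + delta x) - smooth (h + z + delta y) = bavg M (fun u => g (u + z)).
  rewrite smoothB; congr vavg; apply/funext => u; rewrite /g.
  by congr (Phi _ - Phi _); rewrite -!addrA; congr (_ + _); rewrite addrCA.
rewrite smoothB -/(bavg M g).
have -> : 4 * B = 2 * (2 * B) by ring.
apply: (@box_shift _ _ _ _ _ (n - (msize h).+1)) => //; last by lia.
by move=> k kn; rewrite /g !addrA; apply: Phi_edge_le; rewrite msizeD; lia.
Qed.

Notation pl1 p := (mset_of (map fst p)).
Notation pl2 p := (mset_of (map snd p)).

(** Transport the points of [p] one at a time; every intermediate base point is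
    a shift of [h] by at most [l] points. *)
Lemma smooth_linear (l : nat) (p : seq (V * V)) h z : 0 <= B ->
  (msize z + size p <= l)%N -> (M * N + msize h + l < n)%N ->
  nrm (smooth (h + z + pl1 p) - smooth (h + z + pl2 p) -
       \sum_(q <- p) (smooth (h + delta q.1) - smooth (h + delta q.2))) <=
  (size p)%:R * (4 * B * l%:R / M%:R).
Proof.
move=> B0; elim: p z => [|q p IH] z /= zl hn.
  by rewrite !mset_of_nil addr0 subrr big_nil subrr (seminorm0 nP) mul0r.
rewrite !mset_of_cons big_cons.
pose z' := z + pl1 p.
set S := \sum_(q <- p) _; set e := smooth (h + delta q.1) - smooth (h + delta q.2).
have -> : smooth (h + z + (delta q.1 + pl1 p)) - smooth (h + z + (delta q.2 + pl2 p)) - (e + S) =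
   ((smooth (h + z' + delta q.1) - smooth (h + z' + delta q.2)) - e) +
   (smooth (h + (z + delta q.2) + pl1 p) - smooth (h + (z + delta q.2) + pl2 p) - S).
  have -> : h + z' + delta q.1 = h + z + (delta q.1 + pl1 p).
    by rewrite /z' -!addrA; congr (_ + (_ + _)); rewrite addrC.
  have -> : h + z' + delta q.2 = h + (z + delta q.2) + pl1 p.
    by rewrite /z' -!addrA; congr (_ + (_ + _)); rewrite addrC.
  have -> : h + (z + delta q.2) + pl2 p = h + z + (delta q.2 + pl2 p) by rewrite -!addrA.
  set a := smooth (h + z + _); set b := smooth (h + (z + _) + _).
  by rewrite [RHS]addrACA opprD [X in _ = X + _]addrA subrK.
apply: (le_trans (seminormD nP _ _)); rewrite -natr1 mulrDl mul1r [leRHS]addrC; apply: lerD.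
  apply: (le_trans (smooth_edge_shift _ _ _)).
    apply: leq_ltn_trans hn; rewrite leq_add2l /z' msizeD msize_mset_of size_map.
    by apply: leq_trans zl; rewrite addnS leqnSn.
  rewrite ler_wpM2r ?invr_ge0// ler_wpM2l ?mulr_ge0// ler_nat.
  rewrite /z' msizeD msize_mset_of size_map.
  by apply: leq_trans zl; rewrite addnS leqnSn.
by apply: IH => //; rewrite msizeD msize_delta addn1 addSnnS.
Qed.

End Smoothing.
Section Telescope.
Variables (R : realType) (V : finType) (W : lmodType R) (nrm : W -> R).
Hypothesis nP : seminorm nrm.
Notation mset := {ffun V -> nat}.
Variables (dist : V -> V -> R) (C B : R) (n : nat) (Phi : mset -> W).
Hypotheses (B0 : 0 <= B) (PhiL : lip_upto nrm dist C B n Phi).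

Definition pairing (g : V -> R) (u : mset) : R := \sum_v g v * (u v)%:R.

Definition lip (g : V -> R) := forall x y, g x - g y <= dist x y.

Definition noncontracting_upto := forall g, lip g -> forall h u v,
  msize u = msize v -> (msize h + msize u <= n)%N ->
  pairing g u - pairing g v <= nrm (Phi (h + u) - Phi (h + v)).

Lemma pairingD g u v : pairing g (u + v) = pairing g u + pairing g v.
Proof.
by rewrite /pairing -big_split; apply: eq_bigr => x _; rewrite ffunE natrD mulrDr.
Qed.

Lemma pairing0 g : pairing g 0 = 0.
Proof. by rewrite /pairing big1// => x _; rewrite ffunE mulr0. Qed.

Lemma pairing_delta g x : pairing g (delta x) = g x.
Proof.
rewrite /pairing (bigD1 x)//= ffunE eqxx mulr1 big1 ?addr0// => v /negbTE vx.
by rewrite ffunE vx mulr0.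
Qed.

Lemma pairingMn g u S : pairing g (u *+ S) = S%:R * pairing g u.
Proof.
elim: S => [|S IH]; first by rewrite mulr0n pairing0 mul0r.
by rewrite mulrS pairingD IH -natr1 mulrDl mul1r addrC.
Qed.

Lemma pairing_mset_of g s : pairing g (mset_of s) = \sum_(x <- s) g x.
Proof.
elim: s => [|x s IH]; first by rewrite mset_of_nil pairing0 big_nil.
by rewrite mset_of_cons pairingD pairing_delta IH big_cons.
Qed.

Hypothesis PhiN : noncontracting_upto.
Variables M H S : nat.
Hypotheses (M0 : (0 < M)%N) (H0 : (0 < H)%N) (S0 : (0 < S)%N).
Variables (p : seq (V * V)).
Notation l := (size p).
Notation N := #|V|.
Hypothesis n_big : (H * N + M * N + S.+1 * l < n)%N.
Notation pl1 := (mset_of (map fst p)).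
Notation pl2 := (mset_of (map snd p)).
Notation sm := (smooth Phi M).

Definition linear_part (h : mset) : W :=
  \sum_(q <- p) (sm (h + delta q.1) - sm (h + delta q.2)).

Definition step (h : mset) : R := nrm (sm (h + pl1) - sm (h + pl2)).

Lemma step_le h : (M * N + msize h + l < n)%N ->
  step h <= nrm (linear_part h) + l%:R * (4 * B * l%:R / M%:R).
Proof.
move=> hn; have := @smooth_linear _ _ _ _ nP _ _ _ _ _ PhiL _ M0 l p h 0 B0.
rewrite msize0 add0n addr0 => /(_ (leqnn _) hn) h1.
rewrite -lerBlDl; apply: le_trans h1; rewrite /step.
have := seminorm_triangle nP (sm (h + pl1) - sm (h + pl2)) (linear_part h) 0.
by rewrite !subr0; lra.
Qed.

Lemma linear_part_le h : (M * N + msize h < n)%N ->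
  nrm (linear_part h) <= l%:R * (2 * B).
Proof.
move=> hn; apply: (le_trans (seminorm_sum nP _ _ _)).
rewrite mulr_natl -iter_addr_0 -count_predT -big_const_seq; apply: ler_sum => q _.
exact: (smooth_edge_le nP PhiL M0).
Qed.

Lemma step_bounded h : (M * N + msize h + l < n)%N ->
  step h <= 6 * B * l%:R ^+ 2.
Proof.
move=> hn; apply: (le_trans (step_le hn)).
have h1 := @linear_part_le h (leq_ltn_trans (leq_addr _ _) hn).
have h2 : 4 * B * l%:R / M%:R <= 4 * B * l%:R.
  by rewrite ler_pdivrMr ?ltr0n// ler_peMr ?mulr_ge0// ler1n.
have h3 := ler_wpM2l (ler0n R l) h2.
have h4 : l%:R * B <= l%:R ^+ 2 * B.
  rewrite ler_wpM2r// -natrX ler_nat; nia.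
have -> : 6 * B * l%:R ^+ 2 = 2 * (l%:R ^+ 2 * B) + l%:R * (4 * B * l%:R) by ring.
lra.
Qed.

Lemma step_ge0 h : 0 <= step h. Proof. exact: seminorm_ge0. Qed.

(** A displacement by [s] copies of [p] is a chain of [s] steps. Their base points
    are shifts of [h], which the average over a box of side [H] does not feel
    up to a boundary term. *)
Lemma telescope_le (T s : nat) z : (H * N + M * N + T + l < n)%N ->
  (msize z + s * l <= T)%N ->
  bavgr H (fun h => nrm (sm (h + z + pl1 *+ s) - sm (h + z + pl2 *+ s))) <=
  s%:R * (bavgr H step + 2 * (6 * B * l%:R ^+ 2) * T%:R / H%:R).
Proof.
move=> Tn; set b := 6 * B * _.
have b0 : 0 <= b by rewrite !mulr_ge0// exprn_ge0.
elim: s z => [|s IH] z zT.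
  rewrite mul0r /bavgr (@eq_avg _ _ _ (fun=> 0)) ?avg_cst ?card_box_gt0//.
  by move=> u; rewrite !mulr0n subrr (seminorm0 nP).
pose z1 := z + pl1 *+ s; pose z2 := z + pl2.
apply: (@le_trans _ _ (bavgr H (fun h => step (h + z1)) +
    bavgr H (fun h => nrm (sm (h + z2 + pl1 *+ s) - sm (h + z2 + pl2 *+ s))))).
  rewrite /bavgr -avgD; apply: ler_avg => u; rewrite /step.
  have -> : emb u + z + pl1 *+ s.+1 = emb u + z1 + pl1.
    by rewrite mulrS /z1 -!addrA; congr (_ + (_ + _)); rewrite addrC.
  have -> : emb u + z + pl2 *+ s.+1 = emb u + z2 + pl2 *+ s.
    by rewrite mulrS /z2 -!addrA.
  have -> : emb u + z2 + pl1 *+ s = emb u + z1 + pl2.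
    by rewrite /z1 /z2 -!addrA; congr (_ + (_ + _)); rewrite addrC.
  exact: seminorm_triangle.
have z1T : (msize z1 <= T)%N.
  rewrite msizeD msizeMn msize_mset_of size_map mulnC; apply: leq_trans zT.
  by rewrite leq_add2l leq_mul2r leqnSn orbT.
rewrite -natr1 mulrDl mul1r [leRHS]addrC; apply: lerD; last first.
  apply: IH; rewrite msizeD msize_mset_of size_map -addnA -mulSn.
  exact: zT.
apply: (@le_trans _ _ (bavgr H step + 2 * b * (msize z1)%:R / H%:R)).
  apply: (@box_shift_real _ _ _ (n - (M * N + l).+1)) => //.
  - by move=> h; exact: step_ge0.
  - by move=> h hn; apply: step_bounded; lia.
  - lia.
rewrite lerD2l ler_wpM2r ?invr_ge0// ler_wpM2l ?mulr_ge0// ler_nat//.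
Qed.

(** The displacement by [S] copies of [p] is long enough for the smoothing error
    [2 B M N] to be negligible against [S], and it is on average at most [S]
    times a single step, which is nearly linear. *)
Lemma linear_part_lower g : lip g ->
  \sum_(q <- p) (g q.1 - g q.2) <=
  bavgr H (fun h => nrm (linear_part h)) +
  (4 * B * l%:R ^+ 2 / M%:R + 12 * B * l%:R ^+ 3 * S%:R / H%:R + 2 * B * M%:R * N%:R / S%:R).
Proof.
move=> glip; set gam := \sum_(q <- p) _.
have SR : (0 : R) < S%:R by rewrite ltr0n.
have box0 := card_box_gt0 V H0.
pose F h := nrm (sm (h + 0 + pl1 *+ S) - sm (h + 0 + pl2 *+ S)).
have f1 : S%:R * gam <= bavgr H F + 2 * (B * (M * N)%:R).
  rewrite -[leLHS](avg_cst _ box0) -[X in _ + X](avg_cst _ box0) /bavgr -avgD.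
  apply: ler_avg => u; rewrite /F addr0.
  have uH := msize_emb u.
  have s1 : msize (pl1 *+ S) = (l * S)%N by rewrite msizeMn msize_mset_of size_map.
  have s2 : msize (pl2 *+ S) = (l * S)%N by rewrite msizeMn msize_mset_of size_map.
  have := PhiN glip (h := emb u) (u := pl1 *+ S) (v := pl2 *+ S).
  rewrite s1 s2 => /(_ erefl) HN.
  have -> : S%:R * gam = pairing g (pl1 *+ S) - pairing g (pl2 *+ S).
    by rewrite !pairingMn -mulrBr !pairing_mset_of !big_map /gam sumrB.
  apply: le_trans (HN _) _; first by lia.
  have c1 := @smooth_close _ _ _ _ nP _ _ _ _ _ PhiL _ M0 (emb u + pl1 *+ S) B0.
  have c2 := @smooth_close _ _ _ _ nP _ _ _ _ _ PhiL _ M0 (emb u + pl2 *+ S) B0.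
  rewrite msizeD s1 in c1; rewrite msizeD s2 in c2.
  have {}c1 := c1 ltac:(lia); have {}c2 := c2 ltac:(lia).
  rewrite (seminormBC nP) in c1.
  have t1 := seminorm_triangle nP (Phi (emb u + pl1 *+ S)) (sm (emb u + pl1 *+ S)) (Phi (emb u + pl2 *+ S)).
  have t2 := seminorm_triangle nP (sm (emb u + pl1 *+ S)) (sm (emb u + pl2 *+ S)) (Phi (emb u + pl2 *+ S)).
  lra.
have f2 : bavgr H F <= S%:R * (bavgr H step + 2 * (6 * B * l%:R ^+ 2) * (S * l)%:R / H%:R).
  by apply: telescope_le; rewrite ?msize0 ?add0n//; lia.
have f3 : bavgr H step <= bavgr H (fun h => nrm (linear_part h)) + l%:R * (4 * B * l%:R / M%:R).
  rewrite /bavgr -[X in _ + X](avg_cst _ box0) -avgD; apply: ler_avg => u.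
  by apply: step_le; have := msize_emb u; lia.
rewrite natrM in f1; rewrite natrM in f2.
have f4 : S%:R * gam <= S%:R * (bavgr H (fun h => nrm (linear_part h)) +
  (4 * B * l%:R ^+ 2 / M%:R + 12 * B * l%:R ^+ 3 * S%:R / H%:R + 2 * B * M%:R * N%:R / S%:R)).
  have -> : S%:R * (bavgr H (fun h => nrm (linear_part h)) +
    (4 * B * l%:R ^+ 2 / M%:R + 12 * B * l%:R ^+ 3 * S%:R / H%:R + 2 * B * M%:R * N%:R / S%:R)) =
    S%:R * (bavgr H (fun h => nrm (linear_part h)) + l%:R * (4 * B * l%:R / M%:R)) +
    S%:R * (2 * (6 * B * l%:R ^+ 2) * (S%:R * l%:R) / H%:R) + 2 * (B * (M%:R * N%:R)).
    by field; rewrite !pnatr_eq0 -!lt0n M0 H0 S0.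
  apply: (le_trans f1); rewrite lerD2r; apply: (le_trans f2).
  by rewrite mulrDr lerD2r ler_wpM2l.
by rewrite -(ler_pM2l SR).
Qed.

End Telescope.

(** The functions [phi u] are the increments of the smoothed map at the base
    points [u] of a large box, extended linearly to transport plans. *)
Lemma linearization (R : realType) (V : finType) (W : lmodType R) (nrm : W -> R)
    (dist : V -> V -> R) (C B : R) :
  seminorm nrm -> 0 <= B ->
  (forall n, exists Phi : {ffun V -> nat} -> W,
     lip_upto nrm dist C B n Phi /\ noncontracting_upto nrm dist n Phi) ->
  forall (l : nat) (e : R), 0 < e ->
  exists (U : finType) (phi : U -> V -> W),
    [/\ (0 < #|U|)%N,
        forall u x y, nrm (phi u x - phi u y) <= C * dist x y &
        forall (p : seq (V * V)) (g : V -> R), (size p <= l)%N -> lip dist g ->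
          \sum_(q <- p) (g q.1 - g q.2) <=
          avg (fun u => nrm (\sum_(q <- p) (phi u q.1 - phi u q.2))) + e].
Proof.
move=> nP B0 hPhi l e e0.
pose Q : R := 4 * B * l%:R ^+ 2 + 12 * B * l%:R ^+ 3 + 2 * B * #|V|%:R.
have Q0 : 0 <= Q by rewrite !addr_ge0 ?mulr_ge0 ?exprn_ge0.
have [K [K0 QK]] : exists K : nat, (0 < K)%N /\ Q / K%:R <= e.
  exists (Num.bound (Q / e)).+1; split => //.
  rewrite ler_pdivrMr ?ltr0n// mulrC -ler_pdivrMr//; apply/ltW.
  apply: lt_le_trans (archi_boundP (divr_ge0 Q0 (ltW e0))) _.
  by rewrite ler_nat.
(* The errors of linear_part_lower are of order 1 / M, S / H and M / S: all
   become 1 / K. *)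
pose M := K; pose S := (K ^ 2)%N; pose H := (K ^ 3)%N.
have S0 : (0 < S)%N by rewrite expn_gt0 K0.
have H0 : (0 < H)%N by rewrite expn_gt0 K0.
pose n := (H * #|V| + M * #|V| + S.+1 * l).+2.
have [Phi [PhiL PhiN]] := hPhi n.
exists {ffun V -> 'I_H}, (fun u x => smooth Phi M (emb u + delta x)); split.
- exact: card_box_gt0.
- move=> u x y; apply: (smooth_lip nP PhiL K0).
  by have := msize_emb u; rewrite /n; lia.
move=> p g pl glip.
have nb : (H * #|V| + M * #|V| + S.+1 * size p < n)%N.
  by rewrite /n ltnS ltnW// ltnS leq_add2l leq_mul2l pl orbT.
apply: (le_trans (linear_part_lower nP B0 PhiL PhiN K0 H0 S0 nb glip)).
rewrite lerD2l; apply: le_trans QK.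
have KR : (0 : R) < K%:R by rewrite ltr0n.
have plR : (size p)%:R <= l%:R :> R by rewrite ler_nat.
have -> : Q / K%:R = 4 * B * l%:R ^+ 2 / K%:R + 12 * B * l%:R ^+ 3 / K%:R + 2 * B * #|V|%:R / K%:R.
  by rewrite /Q; ring.
rewrite /M /S /H !natrX.
have -> : 12 * B * (size p)%:R ^+ 3 * K%:R ^+ 2 / K%:R ^+ 3 = 12 * B * (size p)%:R ^+ 3 / K%:R.
  by field; rewrite gt_eqF.
have -> : 2 * B * K%:R * #|V|%:R / K%:R ^+ 2 = 2 * B * #|V|%:R / K%:R.
  by field; rewrite gt_eqF.
have pow a : (size p)%:R ^+ a <= l%:R ^+ a :> R by rewrite lerXn2r ?nnegrE.
by rewrite lerD2r lerD// ler_wpM2r ?invr_ge0// ler_wpM2l ?mulr_ge0.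
Qed.
(** * Earth mover distance on the grid *)

Section GridDistance.
Variables (R : realType) (d m : nat).
Notation V := (grid_vertex d m).
Notation G := (@grid_graph d m).

Lemma grid_graphP (x y : V) :
  reflect (exists2 i, path_graph (x i) (y i) & forall j, j != i -> x j = y j) (G x y).
Proof.
apply: (iffP existsP) => [[i /andP[xy /forallP H]]|[i xy H]]; exists i => //.
  by move=> j ji; apply/eqP; exact: (implyP (H j)).
by rewrite xy; apply/forallP => j; apply/implyP => /H ->.
Qed.

Lemma l1_edge (x y : V) : G x y -> l1 x y = 1%N.
Proof.
move=> /grid_graphP[i xy H]; rewrite /l1 (bigD1 i)//= big1 ?addn0.
  by move: xy => /orP[] /eqP /=; lia.
by move=> j /H ->; rewrite subnn.
Qed.

Lemma l1_xx (x : V) : l1 x x = 0%N.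
Proof. by rewrite /l1 big1// => i _; rewrite subnn. Qed.

Lemma l1_path_le (x : V) p : path G x p -> (l1 x (last x p) <= size p)%N.
Proof.
elim: p x => [|y p IH] x /=; first by rewrite l1_xx.
move=> /andP[/l1_edge xy /IH h]; apply: leq_trans (l1_triangle x y _) _.
by rewrite xy add1n ltnS.
Qed.

Lemma l1_step (x y : V) : x != y -> exists2 z, G x z & l1 x y = (l1 z y).+1.
Proof.
move=> xy; have /existsP[i xyi] : [exists i, x i != y i].
  by apply: contraR xy => /existsPn H; apply/eqP/ffunP => i; apply/eqP; rewrite -[_ == _]negbK H.
have [a ax ay] : exists2 a : 'I_m, path_graph (x i) a &
    ((x i - y i) + (y i - x i) = ((a - y i) + (y i - a)).+1)%N.
  have xyn : val (x i) != val (y i) by rewrite (inj_eq val_inj).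
  rewrite /path_graph; have [lt|] := ltnP (x i) (y i).
    have am : ((x i).+1 < m)%N by rewrite (leq_ltn_trans lt)// ltn_ord.
    exists (Ordinal am) => /=; first by rewrite eqxx.
    move: lt; set a := nat_of_ord (x i); set b := nat_of_ord (y i); lia.
  move=> le; have am : ((x i).-1 < m)%N by rewrite (leq_ltn_trans (leq_pred _))// ltn_ord.
  have xi0 : (0 < x i)%N.
    by move: le xyn => /=; case: (nat_of_ord (x i)) => //; case: (nat_of_ord (y i)).
  exists (Ordinal am) => /=; first by rewrite prednK// eqxx orbT.
  move: le xyn xi0 => /=; set a := nat_of_ord (x i); set b := nat_of_ord (y i).
  by move=> h1 /eqP h2 h3; lia.
exists (upd x i a).
  apply/grid_graphP; exists i; first by rewrite upd_eq.
  by move=> j /negbTE ji; rewrite ffunE ji.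
rewrite /l1 (bigD1 i)//= [in RHS](bigD1 i)//= upd_eq ay addSn; congr (_ + _).+1.
by apply: eq_bigr => j /negbTE ji; rewrite ffunE ji.
Qed.

Lemma l1_path (x y : V) : exists p, [/\ path G x p, last x p = y & size p = l1 x y].
Proof.
move: {2}(l1 x y) (erefl (l1 x y)) => n; elim: n x => [|n IH] x xyn.
  have [->|/l1_step[z _]] := eqVneq x y; last by rewrite xyn.
  by exists [::]; rewrite l1_xx.
have [xy|/l1_step[z xz]] := eqVneq x y; first by rewrite xy l1_xx in xyn.
rewrite xyn => -[zy]; have [p [zp lp sp]] := IH z (esym zy).
by exists (z :: p); rewrite /= xz zp lp sp zy.
Qed.

Lemma graph_dist_grid (x y : V) : graph_dist R G x y = (l1 x y)%:R.
Proof.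
have [p [xp lp sp]] := l1_path x y.
apply/eqP; rewrite eq_le; apply/andP; split.
  apply: ge_inf.
    by exists 0 => _ [q _ <-].
  by exists p => //; rewrite sp.
apply: lb_le_inf; first by exists (size p)%:R; exists p.
by move=> _ [q [xq <-] <-]; rewrite ler_nat l1_path_le.
Qed.

End GridDistance.

Section TransportCost.
Variables (R : realType) (T : finType) (dist : T -> T -> R).
Hypothesis dist0 : forall x y, 0 <= dist x y.

Lemma tc_norm_le (mu : {ffun T -> R}) s : transport_repr mu s ->
  tc_norm dist mu <= \sum_(t <- s) t.1.1 * dist t.1.2 t.2.
Proof.
move=> ms; apply: ge_inf; last by exists s.
exists 0 => _ [q [q0 _] <-]; rewrite big_seq sumr_ge0// => t tq.
by rewrite mulr_ge0// q0.
Qed.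

(** All the mass is sent through one point [z]. *)
Lemma transport_repr_exists (mu : {ffun T -> R}) : \sum_v mu v = 0 ->
  exists s, transport_repr mu s.
Proof.
move=> mu0; have [T0|] := posnP #|T|.
  by exists [::]; split=> [t|v]; [rewrite in_nil|case: (fintype0 v T0)].
move=> /card_gt0P[z _].
exists [seq if 0 <= mu x then (mu x, x, z) else (- mu x, z, x) | x <- index_enum T]; split.
  by move=> t /mapP[x _ ->]; case: ifPn => //=; rewrite -ltNge oppr_ge0 => /ltW.
move=> v; rewrite big_map (eq_bigr (fun x => mu x * (x == v)%:R - mu x * (z == v)%:R)).
  rewrite sumrB -mulr_suml mu0 mul0r subr0 (bigD1 v)//= eqxx mulr1 big1 ?addr0//.
  by move=> x /negbTE ->; rewrite mulr0.
by move=> x _; case: ifPn => _ /=; ring.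
Qed.

(** The easy half of Kantorovich duality. *)
Lemma tc_norm_ge (mu : {ffun T -> R}) (g : T -> R) : \sum_v mu v = 0 ->
  (forall x y, g x - g y <= dist x y) ->
  \sum_v g v * mu v <= tc_norm dist mu.
Proof.
move=> mu0 gl; have [s0 ms0] := transport_repr_exists mu0.
apply: lb_le_inf; first by exists (\sum_(t <- s0) t.1.1 * dist t.1.2 t.2); exists s0.
move=> _ [s [sp sE] <-].
under eq_bigr do rewrite sE mulr_sumr.
rewrite exchange_big/= !big_seq; apply: ler_sum => t ts.
have -> : \sum_v g v * (t.1.1 * ((t.1.2 == v)%:R - (t.2 == v)%:R)) =
    t.1.1 * (g t.1.2 - g t.2).
  have pick (w : T) : \sum_v g v * (w == v)%:R = g w.
    rewrite (bigD1 w)//= eqxx mulr1 big1 ?addr0// => v.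
    by rewrite eq_sym => /negbTE ->; rewrite mulr0.
  rewrite -[in RHS](pick t.1.2) -[in RHS](pick t.2) -sumrB mulr_sumr.
  by apply: eq_bigr => v _; ring.
by rewrite ler_wpM2l ?sp.
Qed.

End TransportCost.

Section Cube.
Variables (R : realType) (V : finType) (n : nat).
Hypothesis V0 : (0 < #|V|)%N.
Notation mset := {ffun V -> nat}.
Notation N := (#|V|%:R : R).
Notation eps := (n.+1%:R^-1 : R).

(** Multisets of size at most [n] parametrize probability measures near the
    uniform one, an added point having mass [eps]. *)
Definition cube_mass (h : mset) : {ffun V -> R} :=
  [ffun v => N^-1 + eps * ((h v)%:R - (msize h)%:R / N)].

Lemma cube_measures : exists P : mset -> prob_measure R V,
  forall h, (msize h <= n)%N -> mass (P h) = cube_mass h.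
Proof.
have NR : 0 < N by rewrite ltr0n.
have ok h : (msize h <= n)%N -> exists mu : prob_measure R V, mass mu = cube_mass h.
  move=> hn; have ge0 v : 0 <= cube_mass h v.
    have hn' : (msize h)%:R <= n.+1%:R :> R by rewrite ler_nat ltnW.
    have : eps * ((msize h)%:R / N) <= N^-1.
      by rewrite mulrA ler_piMl ?invr_ge0 ?(ltW NR)// mulrC ler_pdivrMr ?mul1r.
    have : 0 <= eps * (h v)%:R by rewrite mulr_ge0.
    rewrite ffunE mulrBr; set a := eps * (h v)%:R; set b := eps * (_ / N).
    by set c := N^-1; lra.
  have sum1 : \sum_v cube_mass h v = 1.
    under eq_bigr do rewrite ffunE.
    rewrite big_split/= -mulr_sumr sumrB -natr_sum -/(msize h) !sumr_const.
    rewrite -(mulr_natl N^-1) -(mulr_natl (_ / N)) mulfV ?gt_eqF// mulrCA mulfV ?gt_eqF//.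
    by rewrite mulr1 subrr mulr0 addr0.
  by exists (ProbMeasure ge0 sum1).
have [P0 _] : exists mu : prob_measure R V, mass mu = cube_mass 0.
  by apply: ok; rewrite msize0.
have choose (h : mset) : exists mu : prob_measure R V, (msize h <= n)%N -> mass mu = cube_mass h.
  have [/ok[mu muE]|hn] := leqP (msize h) n; first by exists mu.
  by exists P0.
by have [P PE] := choice choose; exists P.
Qed.

Lemma cube_massB h u v : msize u = msize v ->
  cube_mass (h + u) - cube_mass (h + v) = [ffun x => eps * ((u x)%:R - (v x)%:R)].
Proof.
by move=> uv; apply/ffunP => x; rewrite !ffunE !msizeD uv !natrD; ring.
Qed.

Lemma cube_mass_delta h x :
  cube_mass (h + delta x) - cube_mass h = [ffun v => eps * ((x == v)%:R - N^-1)].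
Proof.
apply/ffunP => v; rewrite !ffunE msizeD msize_delta !natrD [v == x]eq_sym.
have NR : N != 0 by rewrite pnatr_eq0 -lt0n.
by set e := eps; field.
Qed.

End Cube.
(** * The space L1 *)

Section L1Norm.
Variable R : realType.
Notation mu := (lebesgue01 R).
Definition L1fun := LfunType mu (@lexx _ _ 1%E).
HB.instance Definition _ := GRing.Lmodule.on L1fun.

Definition L1norm (f : L1fun) : R := fine ('N[mu]_1[EFin \o f])%E.

Lemma L1norm_seminorm : seminorm (W := L1fun) L1norm.
Proof.
split=> [a b|c a]; first exact: ler_LnormD.
apply: EFin_inj; rewrite EFinM /L1norm !finite_norm_fine -LnormZ.
by [].
Qed.

Lemma L1norm_Rintegral (f : L1fun) : L1norm f = \int[mu]_x `|f x|.
Proof. by rewrite /L1norm Lnorm1. Qed.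

Lemma integrable_abs (f : L1fun) : mu.-integrable setT (EFin \o (fun x => `|f x|)).
Proof.
apply/Lfun1_integrable; apply: Lfun_norm; exact: LfunP.
Qed.

Lemma integral_abs_comb (r : seq (R * L1fun)) :
  mu.-integrable setT (EFin \o (fun x => \sum_(q <- r) q.1 * `|q.2 x|)) /\
  \int[mu]_x (\sum_(q <- r) q.1 * `|q.2 x|) = \sum_(q <- r) q.1 * L1norm q.2.
Proof.
elim: r => [|q r [I1 I2]].
  rewrite big_nil; under eq_fun do rewrite big_nil.
  split; first exact: integrable0.
  by rewrite Rintegral_cst ?mul0r.
rewrite big_cons; under eq_fun do rewrite big_cons.
have Iq : mu.-integrable setT (EFin \o (fun x => q.1 * `|q.2 x|)).
  have := integrableZl measurableT q.1 (integrable_abs q.2).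
  by apply: eq_integrable => // x _ /=; rewrite EFinM.
split.
  have := integrableD measurableT Iq I1.
  by apply: eq_integrable => // x _ /=; rewrite EFinD.
rewrite RintegralD// I2 RintegralZl ?L1norm_Rintegral//; exact: integrable_abs.
Qed.

(** Inequalities between absolute values of linear combinations pass from real
    numbers to L1 by integration. *)
Lemma L1norm_transfer (r s : seq (R * L1fun)) :
  (forall x, \sum_(q <- r) q.1 * `|q.2 x| <= \sum_(q <- s) q.1 * `|q.2 x|) ->
  \sum_(q <- r) q.1 * L1norm q.2 <= \sum_(q <- s) q.1 * L1norm q.2.
Proof.
move=> rs; have [Ir <-] := integral_abs_comb r; have [Is <-] := integral_abs_comb s.
by apply: le_Rintegral => // x _; exact: rs.
Qed.

Lemma L1_01_Lfun (f : L1_01 R) : (f : R -> R) \in Lfun mu 1.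
Proof.
apply/andP; split; rewrite inE/=; last exact: Lebesgue_finite.
by move=> mD Y mY; exact: (@measurable_funP _ _ _ _ setT (repr (f : {mfun_ mu, measurableTypeR R >-> measurableTypeR R})) mD Y mY).
Qed.

Definition toL1 (f : L1_01 R) : L1fun := Lfun_Sub (@lexx _ _ 1%E) (L1_01_Lfun f).

Lemma L1_dist_norm (f g : L1_01 R) : L1_dist f g = (L1norm (toL1 f - toL1 g))%:E.
Proof. by rewrite /L1norm finite_norm_fine. Qed.

Lemma L1fun_sumE (I : Type) (r : seq I) (F : I -> L1fun) x :
  (\sum_(i <- r) F i) x = \sum_(i <- r) F i x.
Proof. by elim: r => [|i r IH]; rewrite ?big_nil// !big_cons -IH. Qed.

End L1Norm.
(** * The Sobolev inequality in L1 *)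

Section VectorSobolev.
Variables (R : realType) (d k : nat).
Hypothesis d2 : (2 <= d)%N.
Notation V := (grid_vertex d (2 ^ k)).
Notation W := (L1fun R).
Notation pairs j := (V * {ffun 'I_d -> 'I_(2 ^ j)})%type.

(** Both sides are nonnegative combinations of norms, listed in [r] and [s]. *)
Lemma L1_dipole_sobolev (phi : V -> W) :
  \sum_(j < k) (2 ^+ j) ^+ d.-1 *
    avg (fun w : {ffun 'I_(natoms d k j) -> pairs j} =>
      L1norm (\sum_i (phi (w i).1 - phi (other (w i))))) <=
  16 * d%:R * \sum_i \sum_(x : V) L1norm (phi (upd x i (nxt (x i))) - phi x).
Proof.
pose Om (j : 'I_k) : finType := {ffun 'I_(natoms d k j) -> pairs j}.
pose f (j : 'I_k) (w : Om j) : R * W :=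
  ((2 ^+ j) ^+ d.-1 / #|Om j|%:R, \sum_i (phi (w i).1 - phi (other (w i)))).
pose g (i : 'I_d) (x : V) : R * W := (16 * d%:R, phi (upd x i (nxt (x i))) - phi x).
pose r := [seq f j w | j <- index_enum 'I_k, w <- index_enum (Om j)].
pose s := [seq g i x | i <- index_enum 'I_d, x <- index_enum V].
have rE (h : W -> R) : \sum_(q <- r) q.1 * h q.2 = \sum_(j < k) (2 ^+ j) ^+ d.-1 *
    avg (fun w : Om j => h (\sum_i (phi (w i).1 - phi (other (w i))))).
  rewrite big_allpairs_dep; apply: eq_bigr => j _; rewrite /avg mulrCA mulr_suml.
  by apply: eq_bigr => w _ /=; rewrite mulrC.
have sE (h : W -> R) : \sum_(q <- s) q.1 * h q.2 =
    16 * d%:R * \sum_i \sum_(x : V) h (phi (upd x i (nxt (x i))) - phi x).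
  rewrite big_allpairs_dep mulr_sumr; apply: eq_bigr => i _.
  by rewrite mulr_sumr.
have := @L1norm_transfer R r s; rewrite !rE !sE; apply => x.
rewrite (rE (fun a => `|a x|)) (sE (fun a => `|a x|)).
have := dipole_sobolev d2 (fun v => phi v x); apply: le_trans.
rewrite le_eqVlt; apply/orP; left; apply/eqP; apply: eq_bigr => j _; congr (_ * _).
by apply: eq_avg => w; rewrite L1fun_sumE.
Qed.

End VectorSobolev.

(** * Isometric copies of grids *)

Section UnaryEncoding.
Variables (d' n d m q : nat).
Hypotheses (dq : (d' * q <= d)%N) (nq : (n <= (q * m).+1)%N) (q0 : (0 < q)%N).

Definition digit (a b : nat) : nat := minn m (a - b * m).

Lemma sum_digit a (s : nat) : (\sum_(0 <= b < s) digit a b = minn a (s * m))%N.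
Proof.
elim: s => [|s IH]; first by rewrite big_geq// mul0n minn0.
by rewrite big_nat_recr//= IH /digit mulSn; lia.
Qed.

Lemma sum_digit_dist a b : (a < n)%N -> (b < n)%N ->
  (\sum_(0 <= c < q) ((digit a c - digit b c) + (digit b c - digit a c)) =
   (a - b) + (b - a))%N.
Proof.
move=> an bn; wlog ab : a b an bn / (a <= b)%N.
  move=> H; have [ab|/ltnW ba] := leqP a b; first exact: H.
  by rewrite [RHS]addnC -(H b a)//; apply: eq_bigr => c _; exact: addnC.
have : (\sum_(0 <= c < q) ((digit a c - digit b c) + (digit b c - digit a c)) +
    \sum_(0 <= c < q) digit a c = \sum_(0 <= c < q) digit b c)%N.
  rewrite -big_split/=; apply: eq_bigr => c _; rewrite /digit; lia.
rewrite !sum_digit; lia.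
Qed.

(** The value 0 beyond the last coordinate makes the coordinates of [encode x]
    beyond [d' * q] constant. *)
Definition coord (x : grid_vertex d' n) (a : nat) : nat :=
  oapp (fun i : 'I_d' => nat_of_ord (x i)) 0%N (insub a).

Lemma coord_ord x (i : 'I_d') : coord x i = x i.
Proof. by rewrite /coord insubT//= => p; congr (nat_of_ord (x _)); apply/val_inj. Qed.

(** Each coordinate is written in unary with digits up to [m]: it becomes a
    monotone path through [q] coordinates of the target grid, along which the
    l1 distance is additive. *)
Definition encode (x : grid_vertex d' n) : grid_vertex d m.+1 :=
  [ffun i : 'I_d => inord (digit (coord x (i %/ q)) (i %% q))].

Lemma encode_isometric x y : l1 (encode x) (encode y) = l1 x y.
Proof.
pose D (a b : nat) := ((a - b) + (b - a))%N.
pose F (i : nat) := D (digit (coord x (i %/ q)) (i %% q)) (digit (coord y (i %/ q)) (i %% q)).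
have -> : l1 (encode x) (encode y) = (\sum_(0 <= i < d) F i)%N.
  rewrite big_mkord; apply: eq_bigr => i _; rewrite !ffunE !inordK//; by rewrite ltnS geq_minl.
rewrite (@big_cat_nat _ _ _ (d' * q))//= [X in (_ + X)%N]big1_seq ?addn0; last first.
  move=> i /andP[_]; rewrite mem_index_iota => /andP[ge _].
  rewrite /F; have out z : coord z (i %/ q) = 0%N.
    by rewrite /coord insubN// -leqNgt leq_divRL.
  by rewrite !out.
have blocks s : (\sum_(0 <= i < s * q) F i = \sum_(0 <= a < s) \sum_(0 <= b < q) F (a * q + b))%N.
  elim: s => [|s IH]; first by rewrite mul0n !big_geq.
  rewrite big_nat_recr//= -IH (@big_cat_nat _ _ _ (s * q))//=; last first.
    by rewrite leq_mul2r leqnSn orbT.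
  congr addn; rewrite mulSn addnC -{1}[(s * q)%N]add0n [LHS]big_addn.
  by rewrite addKn; apply: eq_bigr => b _; rewrite addnC.
rewrite blocks big_mkord; apply: eq_bigr => a _.
rewrite -(sum_digit_dist (ltn_ord (x a)) (ltn_ord (y a))) !big_nat.
apply: eq_bigr => b bq; rewrite /F /D divnMDl// divn_small// addn0.
by rewrite modnMDl modn_small// !coord_ord.
Qed.

End UnaryEncoding.

(** * From an embedding to the logarithmic bound *)

Section EmbeddingToLinear.
Variables (R : realType) (d m : nat) (C : R).
Notation V := (grid_vertex d m).
Notation G := (@grid_graph d m).
Variable F : prob_measure R V -> L1_01 R.
Hypotheses (C1 : 1 <= C) (V0 : (0 < #|V|)%N).
Hypothesis bilip : forall mu nu : prob_measure R V,
  ((EMD G mu nu)%:E <= L1_dist (F mu) (F nu))%E /\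
  (L1_dist (F mu) (F nu) <= (C * EMD G mu nu)%:E)%E.
Notation dist := (fun x y : V => (l1 x y)%:R : R).

Lemma EMD_l1 (mu nu : prob_measure R V) :
  EMD G mu nu = tc_norm dist (mass mu - mass nu).
Proof.
by rewrite /EMD; congr tc_norm; apply/funext => x; apply/funext => y; rewrite graph_dist_grid.
Qed.

Lemma bilip_norm (mu nu : prob_measure R V) :
  EMD G mu nu <= L1norm (toL1 (F mu) - toL1 (F nu)) <= C * EMD G mu nu.
Proof.
have [] := bilip mu nu; rewrite L1_dist_norm !lee_fin => -> ->//.
Qed.

(** Rescaling by [n + 1] compensates the mass [1 / (n + 1)] of a point of the
    multiset. *)
Lemma embedding_cube (n : nat) : exists Phi : {ffun V -> nat} -> L1fun R,
  lip_upto (@L1norm R) dist C (C * \sum_(x : V) \sum_(y : V) (l1 x y)%:R) n Phi /\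
  noncontracting_upto (@L1norm R) dist n Phi.
Proof.
have nP := L1norm_seminorm R.
have C0 : 0 <= C by exact: le_trans ler01 C1.
have [P PE] := @cube_measures R V n V0.
have NR : (0 : R) < #|V|%:R by rewrite ltr0n.
have nR : (0 : R) < n.+1%:R by rewrite ltr0n.
pose Phi h : L1fun R := n.+1%:R *: toL1 (F (P h)).
have PhiB h k : L1norm (Phi h - Phi k) = n.+1%:R * L1norm (toL1 (F (P h)) - toL1 (F (P k))).
  by rewrite /Phi -scalerBr (seminormZ nP) ger0_norm.
have upper h k (s : seq (R * V * V)) (c : R) : transport_repr (mass (P h) - mass (P k)) s ->
    n.+1%:R * \sum_(t <- s) t.1.1 * dist t.1.2 t.2 <= c -> L1norm (Phi h - Phi k) <= C * c.
  move=> sr sc; rewrite PhiB.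
  have /andP[_ up] := bilip_norm (P h) (P k).
  have := ler_wpM2l (ltW nR) up.
  have le := tc_norm_le (dist := dist) (fun x y => ler0n R (l1 x y)) sr.
  rewrite -EMD_l1 in le; move/le_trans; apply; rewrite mulrCA ler_wpM2l//.
  by apply: le_trans sc; rewrite ler_wpM2l.
exists Phi; split.
  move=> h hn; split=> [x y|x].
    apply: (@upper _ _ [:: (n.+1%:R^-1, x, y)]); last first.
      by rewrite big_seq1 /= mulrA mulfV ?mul1r// gt_eqF.
    split=> [t|v]; first by rewrite inE => /eqP -> /=; rewrite invr_ge0.
    rewrite !PE ?msizeD ?msize_delta ?addn1//.
    rewrite cube_massB ?msize_delta// big_seq1 !ffunE /=.
    by rewrite [v == x]eq_sym [v == y]eq_sym.
  apply: (@upper _ _ [seq (n.+1%:R^-1 / #|V|%:R, x, y) | y <- index_enum V]); last first.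
    rewrite big_map /= -mulr_sumr mulrA [n.+1%:R * _]mulrA mulfV ?gt_eqF// mul1r.
    rewrite mulrC ler_pdivrMr// [leRHS]mulrC.
    apply: (@le_trans _ _ (\sum_(x : V) \sum_(y : V) (l1 x y)%:R)).
      by rewrite [leRHS](bigD1 x)//= lerDl sumr_ge0// => a _; exact: sumr_ge0.
    by rewrite ler_peMl ?ler1n// sumr_ge0// => a _; exact: sumr_ge0.
  split=> [t /mapP[y _ ->]|v] /=; first by rewrite divr_ge0.
  rewrite !PE ?msizeD ?msize_delta ?addn1//; last exact: ltnW.
  rewrite cube_mass_delta// big_map ffunE /= -mulr_sumr sumrB sumr_const.
  rewrite (bigD1 v)//= eqxx big1 ?addr0; last by move=> y /negbTE ->.
  rewrite -(mulr_natl (x == v)%:R) mulr1n -[X in X * (x == v)%:R - 1]/(#|V|%:R).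
  by set e := n.+1%:R^-1; field; rewrite gt_eqF.
move=> g gl h u v uv hn; rewrite PhiB.
have /andP[lo _] := bilip_norm (P (h + u)) (P (h + v)).
apply: le_trans (ler_wpM2l (ltW nR) lo); rewrite EMD_l1.
have hv : (msize h + msize v <= n)%N by rewrite -uv.
have mu0 : \sum_x (mass (P (h + u)) - mass (P (h + v))) x = 0.
  by under eq_bigr do rewrite !ffunE; rewrite sumrB !mass_sum1 subrr.
have := tc_norm_ge (dist := dist) mu0 gl.
move/(ler_wpM2l (ltW nR)); apply: le_trans.
rewrite !PE ?msizeD// cube_massB// mulr_sumr /pairing -sumrB.
apply: ler_sum => x _; rewrite ffunE le_eqVlt; apply/orP; left; apply/eqP.
by move: nR; set e := n.+1%:R => e0; field; rewrite gt_eqF.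
Qed.

End EmbeddingToLinear.
Lemma avg_exchange (R : realType) (T U : finType) (f : T -> U -> R) :
  avg (fun t => avg (f t)) = avg (fun u => avg (f^~ u)).
Proof.
rewrite /avg -!mulr_suml exchange_big/=.
by rewrite mulrAC.
Qed.

Section Core.
Variables (R : realType) (d m k d0 : nat) (C : R).
Hypotheses (d2 : (2 <= d)%N).
Notation V' := (grid_vertex d (2 ^ k)).
Notation V := (grid_vertex d0 m).
Notation W := (L1fun R).
Notation pairs j := (V' * {ffun 'I_d -> 'I_(2 ^ j)})%type.
Variable iota : V' -> V.
Hypothesis iotaP : forall x y, l1 (iota x) (iota y) = l1 x y.

Lemma l1_nxt_le (x : V') i : (l1 (upd x i (nxt (x i))) x <= 1)%N.
Proof.
rewrite /l1 (bigD1 i)//= big1 ?addn0; last first.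
  by move=> j /negbTE ji; rewrite ffunE ji subnn.
rewrite upd_eq -[nat_of_ord (nxt _)]/(val _) val_nxt; case: ifP => _ /=; lia.
Qed.

(** The test function for the dipoles [w] at scale [2 ^ j] is the capped distance
    to the sinks. The cost of the dipoles at each of the [k - 5] scales, weighted
    by [(2 ^ j) ^ (d - 1)], is at least a multiple of [d ^ 3] times the number of
    vertices. *)
Lemma linear_distortion_ge (U : finType) (phi : U -> V -> W) (e : R) :
  (0 < #|U|)%N -> 0 <= C -> 0 <= e ->
  (forall u x y, L1norm (phi u x - phi u y) <= C * (l1 x y)%:R) ->
  (forall (p : seq (V * V)) (g : V -> R), (size p <= \sum_(j < k) natoms d k j)%N ->
     lip (fun x y => (l1 x y)%:R) g ->
     \sum_(q <- p) (g q.1 - g q.2) <=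
     avg (fun u => L1norm (\sum_(q <- p) (phi u q.1 - phi u q.2))) + e) ->
  (k - 5)%:R * (d%:R ^+ 3 * #|V'|%:R / 64) <=
  16 * d%:R ^+ 2 * #|V'|%:R * C + e * \sum_(j < k) (2 ^+ j) ^+ d.-1.
Proof.
move=> U0 C0 e0 phiC phiN.
pose S u (j : nat) (w : {ffun 'I_(natoms d k j) -> pairs j}) : W :=
  \sum_i (phi u (iota (w i).1) - phi u (iota (other (w i)))).
pose E u (j : nat) := avg (fun w => L1norm (@S u j w)).
have w0 (j : nat) : 0 <= (2 ^+ j) ^+ d.-1 :> R by rewrite !exprn_ge0.
have E0 u j : 0 <= E u j by apply: avg_ge0 => w; exact: (seminorm_ge0 (L1norm_seminorm R)).
have upper u : \sum_(j < k) (2 ^+ j) ^+ d.-1 * E u j <= 16 * d%:R ^+ 2 * #|V'|%:R * C.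
  apply: (le_trans (L1_dipole_sobolev d2 (fun v => phi u (iota v)))).
  have -> : 16 * d%:R ^+ 2 * #|V'|%:R * C = 16 * d%:R * (d%:R * (#|V'|%:R * C)) by ring.
  rewrite ler_wpM2l//; apply: (@le_trans _ _ (\sum_(i < d) \sum_(x : V') C)); last first.
    by rewrite !sumr_const card_ord -(mulr_natl C) -(mulr_natl (_ * C)).
  apply: ler_sum => i _; apply: ler_sum => x _; apply: (le_trans (phiC _ _ _)).
  by rewrite ler_piMr// iotaP -[leRHS]/(1%:R) ler_nat l1_nxt_le.
have lower (j : nat) : (5 <= j)%N -> (j < k)%N ->
    d%:R ^+ 3 * #|V'|%:R / 64 <= (2 ^+ j) ^+ d.-1 * (avg (fun u => E u j) + e).
  move=> j5 jk.
  have W0 : (0 < #|{: {ffun 'I_(natoms d k j) -> pairs j}}|)%N.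
    by rewrite card_ffun expn_gt0 card_pairs_gt0.
  have h := avg_sink_dist_ge R d2 j5 jk.
  have {}h : (natoms d k j)%:R * ((d * 2 ^ (j - 5))%:R / 2) <= avg (fun u => E u j) + e.
    apply: (le_trans h); rewrite /E avg_exchange -[X in _ + X](avg_cst _ W0) -avgD.
    apply: ler_avg => w.
    pose y i := iota (other (w i)).
    pose g z : R := (capped_dist (d * 2 ^ (j - 5)) y z)%:R.
    have glip : lip (fun x y => (l1 x y)%:R) g.
      by move=> a b; rewrite lerBlDl -natrD ler_nat capped_dist_lip.
    pose p := [seq (iota (w i).1, y i) | i <- index_enum 'I_(natoms d k j)].
    have sp : (size p <= \sum_(j < k) natoms d k j)%N.
      rewrite size_map -sum1_size sum_nat_const card_ord muln1.
      by rewrite (bigD1 (Ordinal jk))//= leq_addr.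
    have := phiN p g sp glip.
    rewrite (@eq_avg _ _ _ (fun u => L1norm (@S u j w))); last by move=> u; rewrite big_map.
    apply: le_trans; rewrite big_map.
    apply: ler_sum => i _; rewrite /g /= capped_dist_at subr0 ler_nat.
    rewrite /sink_dist /capped_dist; apply: eq_leq; apply: eq_bigr => i' _.
    by rewrite iotaP.
  apply: le_trans (ler_wpM2l (w0 j) h).
  have dd : d = d.-1.+1 by rewrite prednK// (leq_trans _ d2).
  rewrite card_ffun !card_ord /natoms natrM !natrX natrM natrX.
  rewrite -{1}(subnK (ltnW jk)) exprD exprMn.
  have -> : (2 : R) ^+ j = 2 ^+ (j - 5) * 32.
    by rewrite -[X in 2 ^+ X](subnK j5) exprD; congr (_ * _); ring.
  set L := 2 ^+ (j - 5); set K := _ ^+ d.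
  have -> : (L * 32) ^+ d = (L * 32) * (L * 32) ^+ d.-1 by rewrite -exprS -dd.
  by rewrite le_eqVlt; apply/orP; left; apply/eqP; field.
set A := d%:R ^+ 3 * _ / _ in lower *.
pose t (j : nat) := (2 ^+ j) ^+ d.-1 * (avg (fun u => E u j) + e).
have t0 j : 0 <= t j by rewrite mulr_ge0// addr_ge0// avg_ge0.
apply: (@le_trans _ _ (\sum_(j < k) t j)).
  rewrite -(big_mkord xpredT t); have [k5|/ltnW k5] := leqP k 5.
    by rewrite (eqP k5) mul0r sumr_ge0.
  rewrite (@big_cat_nat _ _ _ 5)//=; apply: (@le_trans _ _ (\sum_(5 <= j < k) t j)).
    rewrite mulr_natl -sumr_const_nat !big_nat; apply: ler_sum => j /andP[j5 jk].
    exact: lower.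
  by rewrite lerDr sumr_ge0.
rewrite /t; under eq_bigr do rewrite mulrDr [_ * e]mulrC.
rewrite big_split/= -mulr_sumr lerD2r.
under eq_bigr do rewrite -avgZ.
rewrite -avg_sum -[leRHS](avg_cst _ U0); apply: ler_avg => u; exact: upper.
Qed.

End Core.
Section Distortion.
Variables (R : realType).

Lemma distortion_ge (d k d0 m : nat) (C : R)
    (iota : grid_vertex d (2 ^ k) -> grid_vertex d0 m)
    (F : prob_measure R (grid_vertex d0 m) -> L1_01 R) :
  (2 <= d)%N -> (0 < m)%N -> (forall x y, l1 (iota x) (iota y) = l1 x y) -> 1 <= C ->
  (forall mu nu : prob_measure R (grid_vertex d0 m),
     ((EMD (@grid_graph d0 m) mu nu)%:E <= L1_dist (F mu) (F nu))%E /\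
     (L1_dist (F mu) (F nu) <= (C * EMD (@grid_graph d0 m) mu nu)%:E)%E) ->
  (k - 5)%:R * d%:R <= 1024 * C.
Proof.
move=> d2 m0 iotaP C1 bilip.
have C0 : 0 <= C by exact: le_trans ler01 C1.
have V0 : (0 < #|grid_vertex d0 m|)%N by rewrite card_ffun !card_ord expn_gt0 m0.
have V'0 : (0 < #|grid_vertex d (2 ^ k)|)%N by rewrite card_ffun !card_ord !expn_gt0.
have VR : (0 : R) < #|grid_vertex d (2 ^ k)|%:R by rewrite ltr0n.
have dR : (0 : R) < d%:R by rewrite ltr0n (leq_trans _ d2).
have B0 : 0 <= C * \sum_(x : grid_vertex d0 m) \sum_(y : grid_vertex d0 m) (l1 x y)%:R.
  by rewrite mulr_ge0// sumr_ge0// => x _; rewrite sumr_ge0.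
have lin := linearization (L1norm_seminorm R) B0 (embedding_cube C1 V0 bilip)
  (\sum_(j < k) natoms d k j).
pose X : R := (k - 5)%:R * (d%:R ^+ 3 * #|grid_vertex d (2 ^ k)|%:R / 64).
pose Y : R := 16 * d%:R ^+ 2 * #|grid_vertex d (2 ^ k)|%:R * C.
have XY : X <= Y.
  apply/ler_addgt0Pr => e e0.
  pose Z : R := \sum_(j < k) (2 ^+ j) ^+ d.-1.
  have Z0 : 0 <= Z by apply: sumr_ge0 => j _; rewrite !exprn_ge0.
  have Z1 : 0 < Z + 1 by rewrite ltr_wpDl.
  have [U [phi [U0 phiC phiN]]] := lin (e / (Z + 1)) (divr_gt0 e0 Z1).
  have := linear_distortion_ge d2 iotaP U0 C0 (ltW (divr_gt0 e0 Z1)) phiC phiN.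
  move/le_trans; apply; rewrite lerD2l -/Z mulrAC ler_pdivrMr// ler_wpM2l ?(ltW e0)//.
  by rewrite lerDl.
have c0 : 0 < d%:R ^+ 2 * #|grid_vertex d (2 ^ k)|%:R / 64 :> R.
  by rewrite divr_gt0 ?mulr_gt0 ?exprn_gt0.
rewrite -(ler_pM2l c0); move: XY; rewrite /X /Y.
set n := #|grid_vertex d (2 ^ k)|%:R; set K := (k - 5)%:R; set D := d%:R.
have -> : K * (D ^+ 3 * n / 64) = D ^+ 2 * n / 64 * (K * D) by ring.
have -> : D ^+ 2 * n / 64 * (1024 * C) = 16 * D ^+ 2 * n * C by field.
by [].
Qed.

End Distortion.

Section LogarithmicBound.
Variables (R : realType) (d m : nat) (C : R).
Notation V := (grid_vertex d m.+1).
Variable F : prob_measure R V -> L1_01 R.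
Hypotheses (d2 : (2 <= d)%N) (C1 : 1 <= C).
Hypothesis bilip : forall mu nu : prob_measure R V,
  ((EMD (@grid_graph d m.+1) mu nu)%:E <= L1_dist (F mu) (F nu))%E /\
  (L1_dist (F mu) (F nu) <= (C * EMD (@grid_graph d m.+1) mu nu)%:E)%E.

Lemma encoded_distortion_ge (q n k : nat) : (0 < q)%N -> (2 <= n)%N ->
  (n * q <= d)%N -> (2 ^ k <= (q * m).+1)%N -> (k - 5)%:R * n%:R <= 1024 * C.
Proof.
move=> q0 n2 nqd kq; have iso := encode_isometric nqd kq q0.
exact: (distortion_ge n2 (ltn0Sn m) iso C1 bilip).
Qed.

Lemma ln_le_exponent (a : nat) : (m.+1 <= 2 ^ a)%N -> ln (m.+1%:R : R) <= a%:R.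
Proof.
move=> ma; apply: (@le_trans _ _ (ln (2 ^+ a))).
  by rewrite ler_ln ?posrE ?exprn_gt0// -natrX ler_nat.
rewrite lnXn// -[leLHS]mulr_natl ler_piMr//.
by apply: le_trans (ler_ln_sub1 (ltr0Sn _ _)) _; rewrite (_ : 2 - 1 = 1)//; ring.
Qed.

(** The dyadic subgrid of side [2 ^ k], with [2 ^ k <= m + 1 < 2 ^ (k + 1)], has
    [k - 5 >= (k + 1) / 12] useful scales. *)
Lemma ln_card_large_side : (64 <= m.+1)%N -> d%:R * ln (m.+1%:R : R) <= 12 * (1024 * C).
Proof.
move=> m64; pose k := trunc_log 2 m.+1.
have k6 : (6 <= k)%N by rewrite trunc_log_max.
have km : (2 ^ k <= m.+1)%N by rewrite trunc_logP.
have mk : (m.+1 <= 2 ^ k.+1)%N by rewrite ltnW// trunc_log_ltn.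
have twelve a : (6 <= a)%N -> (a.+1 <= 12 * (a - 5))%N by lia.
have k5 : k.+1%:R <= 12 * (k - 5)%:R :> R by rewrite -natrM ler_nat twelve.
have : (k - 5)%:R * d%:R <= 1024 * C.
  by apply: (@encoded_distortion_ge 1); rewrite ?muln1 ?mul1n.
rewrite -(@ler_pM2l _ 12)//; apply: le_trans.
rewrite mulrA [leRHS]mulrC ler_wpM2l//.
exact: le_trans (ln_le_exponent mk) k5.
Qed.

(** In dimension at least 128 there is room for a grid of side [64] in unary, of
    dimension [d / 64] and with one useful scale; in bounded dimension the
    number of vertices is bounded and [1 <= C] suffices. *)
Lemma ln_card_small_side : (0 < m)%N -> (m.+1 < 64)%N ->
  d%:R * ln (m.+1%:R : R) <= 768 * (1024 * C).
Proof.
move=> m0 m64.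
have lnm : ln (m.+1%:R : R) <= 6 by apply: (@ln_le_exponent 6); rewrite ltnW.
have lnd : d%:R * ln (m.+1%:R : R) <= d%:R * 6 by rewrite ler_wpM2l.
have [n nd dn] : exists2 n, (n * 64 <= d)%N & (d <= 64 * n.+1)%N.
  by exists (d %/ 64)%N; [exact: leq_trunc_div|rewrite mulnC ltnW// ltn_ceil].
have dnR : d%:R <= 64 * n.+1%:R :> R by rewrite -natrM ler_nat.
have [n2|n2] := leqP 2 n.
  have : (6 - 5)%:R * n%:R <= 1024 * C.
    apply: (@encoded_distortion_ge 64) => //.
    by rewrite (@leq_trans (64 * 1))// leqW// leq_pmul2l.
  have : n.+1%:R <= 2 * n%:R :> R.
    by rewrite -natrM ler_nat mul2n -addnn -addn1 leq_add2l ltnW.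
  by rewrite mul1r; set c := 1024 * C; lra.
have : n.+1%:R <= 2 :> R by rewrite ler_nat.
have : 1 <= 1024 * C by rewrite mulr_ege1// ler1n.
by set c := 1024 * C; lra.
Qed.

End LogarithmicBound.

Theorem corollary1p2 (R : realType) :
  exists c : R, 0 < c /\
    forall m d : nat, (1 <= m)%N -> (2 <= d)%N ->
    let G := @grid_graph d m in
    let N := (m ^ d)%N in
    [/\ #|grid_vertex d m| = N,
        c * ln (N%:R : R) = c * d%:R * ln (m%:R : R) &
        forall (C : R) (F : prob_measure R (grid_vertex d m) -> L1_01 R),
          1 <= C ->
          (forall mu nu : prob_measure R (grid_vertex d m),
             ((EMD G mu nu)%:E <= L1_dist (F mu) (F nu))%E /\
             (L1_dist (F mu) (F nu) <= (C * EMD G mu nu)%:E)%E) ->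
          c * ln (N%:R : R) <= C].
Proof.
have K0 : (0 : R) < 768 * 1024 by rewrite mulr_gt0 ?ltr0n.
exists (768 * 1024)^-1; split; first by rewrite invr_gt0.
move=> [//|m] d _ d2 G N.
have lnN : ln (N%:R : R) = d%:R * ln (m.+1%:R : R).
  by rewrite /N natrX lnXn// mulr_natl.
split; first by rewrite card_ffun !card_ord.
  by rewrite lnN mulrA.
move=> C F C1 bilip; rewrite lnN mulrC ler_pdivrMr// [leRHS]mulrC -mulrA.
have C0 : 0 <= 1024 * C by rewrite mulr_ge0 ?ler0n ?(le_trans ler01 C1).
have [m0|m0] := posnP m; first by rewrite m0 ln1 mulr0 mulr_ge0 ?ler0n.
have [m64|m64] := leqP 64 m.+1.
  apply: le_trans (ln_card_large_side d2 C1 bilip m64) _.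
  by rewrite ler_wpM2r// ler_nat.
exact: (ln_card_small_side C1 bilip m0 m64).
Qed.
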